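(* Let $M$ be a loopless matroid of rank $r$ on a finite ground set $E$ and let $\mathcal G$ be a building set of $M$ containing $E$. The formal canonical class $K_{M,\mathcal G}:=-c_1(T_{M,\mathcal G})$ satisfies $$K_{M,\mathcal G}=-r\alpha+\sum_{F\in\mathcal G\setminus\{E\}}(\operatorname{rk}(F)-1)x_F ;$$ equivalently, $\omega_{M,\mathcal G}:=\mathcal O(K_{M,\mathcal G})=\det(T_{M,\mathcal G}^\vee)$. Moreover, if $\mathcal B$ and $\mathcal B^+=\mathcal B\cup\{F\}$ are building sets of $M$ containing $E$, with $F\notin\mathcal B$, and $\ell=|\operatorname{Fac}_{\mathcal B}(F)|$, then $$K_{M,\mathcal B^+}=\rho_F^*K_{M,\mathcal B}+(\ell-1)x_F.$$
   Context: $M$ is a loopless matroid on a finite nonempty set $E$ with rank function $\operatorname{rk}$, $r=\operatorname{rk}(E)$, lattice of flats $\mathcal L(M)$ (minimum $\emptyset$, maximum $E$, join $\vee$). A subset $\mathcal G\subseteq\mathcal L(M)\setminus\{\emptyset\}$ is a building set if for every nonempty flat $F$, with $G_1,\dots,G_s$ the maximal elements of $\mathcal G$ contained in $F$, the join map $[\emptyset,G_1]\times\cdots\times[\emptyset,G_s]\to[\emptyset,F]$ is a poset isomorphism; $\operatorname{Fac}_{\mathcal G}(F)=\{G_1,\dots,G_s\}$. A subset $\mathcal S\subseteq\mathcal G\setminus\{E\}$ is $\mathcal G$-nested if every collection of $m\ge2$ pairwise incomparable elements of $\mathcal S$ has join not in $\mathcal G$. In $N_E=\mathbb Z^E/\mathbb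 Z(1,\dots,1)$ let $v_F$ be the image of $\sum_{i\in F}e_i$; the nested-set fan $\Sigma_{M,\mathcal G}$ consists of the cones $\operatorname{cone}(v_F:F\in\mathcal S)$, $\mathcal S$ $\mathcal G$-nested, and $X_{M,\mathcal G}$ is its smooth toric variety. $\mathsf A(M,\mathcal G)$ is the Chow ring of $X_{M,\mathcal G}$, presented as $\mathbb Z[x_F:F\in\mathcal G\setminus\{E\}]$ modulo monomials $x_{F_1}\cdots x_{F_m}$ for non-nested $\{F_1,\dots,F_m\}$ and the linear forms $\sum_{F\ni i}x_F-\sum_{F\ni j}x_F$ ($i,j\in E$, sums over $F\in\mathcal G\setminus\{E\}$); $x_F$ is the class of the torus-invariant divisor of $v_F$. Put $\alpha=\sum_{F\in\mathcal G\setminus\{E\},\,i\in F}x_F$ (independent of $i\in E$). $\mathsf K(M,\mathcal G)=K_0(X_{M,\mathcal G})$; $\mathcal O(D)$ is the line bundle of $D\in\mathsf A^1(M,\mathcal G)$. For $F\in\mathcal G\setminus\{E\}$ put $\theta_F^{\mathcal G}=\alpha-\sum_{H\in\mathcal G,\,F\subseteq H\subsetneq E}x_H$. The tangent class is $$T_{M,\mathcal G}:=r[\mathcal O(\alpha)]-[\mathcal O]+\sum_{F\in\mathcal G\setminus\{E\}}\Big([\mathcal O(x_F)]-[\mathcal O]+\operatorname{rk}(F)\big([\mathcal O(\theta_F^{\mathcal G})]-[\mathcal O(\theta_F^{\mathcal G}+x_F)]\big)\Big)\in\mathsf K(M,\mathcal G).$$ For $\mathcal B^+=\mathcal B\cup\{F\}$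 as in the claim, with $\operatorname{Fac}_{\mathcal B}(F)=\{F_1,\dots,F_\ell\}$, the fan $\Sigma_{M,\mathcal B^+}$ is the stellar subdivision of $\Sigma_{M,\mathcal B}$ at $\operatorname{cone}(v_{F_1},\dots,v_{F_\ell})$, with new ray $v_F$, and $\rho_F:X_{M,\mathcal B^+}\to X_{M,\mathcal B}$ is the induced toric blow-up. *)

(* Defs.v *)
From HB Require Import structures.
From mathcomp Require Import all_boot all_order all_algebra.
From mathcomp Require Import boolp.
From mathcomp Require Import freeg mpoly.

Set Implicit Arguments.
Unset Strict Implicit.
Unset Printing Implicit Defensive.

Import GRing.Theory.
Local Open Scope ring_scope.

Definition some_st (T : Type) (x0 : T) (P : T -> Prop) : T :=
  if pselect (exists x, P x) is left h then sval (cid h) else x0.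

Record matroid (E : finType) := Matroid {
  rk :> {set E} -> nat;
  rk_le_card : forall A : {set E}, (rk A <= #|A|)%N;
  rk_mono : forall A B : {set E}, A \subset B -> (rk A <= rk B)%N;
  rk_submod : forall A B : {set E}, (rk (A :|: B) + rk (A :&: B) <= rk A + rk B)%N }.

Section Matroids.
Variables (E : finType) (M : matroid E).
Implicit Types (A F H : {set E}) (G S : {set {set E}}).

Definition loopless : Prop := forall i : E, M [set i] = 1%N.

Definition closure A : {set E} := [set i | M (i |: A) == M A].

Definition flat F : bool := closure F == F.

Definition joinF S : {set E} := closure (cover S).

Definition Fac G F : {set {set E}} :=
  [set H | maxset [pred H' : {set E} | (H' \in G) && (H' \subset F)] H].

(* The elements of the product of the intervals [0, H], H in Fac G F, encoded *)
(* as functions on all subsets of E that vanish outside Fac G F.              *)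
Definition fac_prod G F (phi : {ffun {set E} -> {set E}}) : bool :=
  [forall H, if H \in Fac G F then flat (phi H) && (phi H \subset H)
             else phi H == set0].

Definition fac_join G F (phi : {ffun {set E} -> {set E}}) : {set E} :=
  joinF [set phi H | H in Fac G F].

Definition building_set G : Prop :=
  (forall F, F \in G -> flat F /\ F != set0) /\
  (forall F, flat F -> F != set0 ->
     (forall phi psi, fac_prod G F phi -> fac_prod G F psi ->
        (fac_join G F phi \subset fac_join G F psi) =
        [forall H, phi H \subset psi H]) /\
     (forall K, flat K -> K \subset F ->
        exists2 phi, fac_prod G F phi & fac_join G F phi = K)).

Definition antichain S : bool :=
  [forall H in S, forall H' in S, (H \subset H') ==> (H == H')].

Definition nested G S : bool :=
  (S \subset G :\ setT) &&
  [forall S' : {set {set E}},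
     [&& S' \subset S, 1 < #|S'| & antichain S']%N ==> (joinF S' \notin G)].

End Matroids.

Definition ideal_gen (R : comNzRingType) (X : R -> Prop) (x : R) : Prop :=
  forall J : R -> Prop, J 0 -> (forall a u v, J u -> J v -> J (a * u + v)) ->
    (forall y, X y -> J y) -> J x.

Section Chow.
Variables (E : finType) (M : matroid E) (G : {set {set E}}).
Implicit Types (F : {set E}) (S : {set {set E}}).

Definition chow_poly : comNzRingType := {mpoly int[#|G :\ setT|]}.

(* The variable attached to F; the sum has exactly one term if F is in        *)
(* G :\ setT, and none otherwise.                                             *)
Definition xvar F : chow_poly :=
  \sum_(j < #|G :\ setT| | enum_val j == F) 'X_j.

Definition alpha_poly (i : E) : chow_poly :=
  \sum_(F in G :\ setT | i \in F) xvar F.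

Variant chow_rel : chow_poly -> Prop :=
| NonNestedRel S of S \subset G :\ setT & ~~ nested M G S :
    chow_rel (\prod_(F in S) xvar F)
| LinearRel (i j : E) : chow_rel (alpha_poly i - alpha_poly j).

Definition chow_ideal : {pred chow_poly} :=
  fun p => `[< ideal_gen chow_rel p >].

Lemma xvar_coef0 F : (xvar F)@_0 = 0.
Proof.
rewrite raddf_sum big1 // => j _.
by rewrite /= mcoeffX; case: eqP => // /eqP; rewrite mnm1_eq0.
Qed.

Lemma nested0 : nested M G set0.
Proof.
rewrite /nested sub0set; apply/forallP => S; apply/implyP => /and3P[].
by rewrite subset0 => /eqP->; rewrite cards0.
Qed.

Lemma chow_ideal_closed : idealr_closed chow_ideal.
Proof.
split.
- by apply/asboolP => J J0.
- apply/asboolP => /(_ (fun p => p@_0 = 0)) H.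
  have: (1 : chow_poly)@_0 = 0.
    apply: H; first by rewrite mcoeff0.
      by move=> a u v hu hv; rewrite mcoeffD (rmorphM (mcoeff 0%MM)) /= hu hv mulr0 addr0.
    move=> y [S SG nS|i j].
      have [S0|[F FS]] := set_0Vmem S; first by rewrite S0 nested0 in nS.
      by rewrite (bigD1 F) //= (rmorphM (mcoeff 0%MM)) /= xvar_coef0 mul0r.
    by rewrite mcoeffB /alpha_poly !raddf_sum !big1 ?subrr // => F _;
      rewrite /= xvar_coef0.
  by rewrite mcoeff1 eqxx.
- move=> a u v /asboolP hu /asboolP hv; apply/asboolP => J J0 JD JX.
  exact: (JD _ _ _ (hu J J0 JD JX) (hv J J0 JD JX)).
Qed.

HB.instance Definition _ := isIdealr.Build chow_poly chow_ideal chow_ideal_closed.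

Definition chow : comNzRingType := {ideal_quot chow_ideal}.

Definition chow_pi (p : chow_poly) : chow := (\pi p)%qT.

Definition x_ F : chow := chow_pi (xvar F).

Definition alpha (i : E) : chow := \sum_(F in G :\ setT | i \in F) x_ F.

Lemma alpha_indep (i j : E) : alpha i = alpha j.
Proof.
rewrite /alpha /x_ /chow_pi -!(raddf_sum (\pi_chow)%qT).
apply/eqP; rewrite -Quotient.idealrBE; apply/asboolP => J _ _ JX.
exact/JX/LinearRel.
Qed.

(* The class of the torus-invariant divisor with multiplicity a F along the   *)
(* divisor of the ray of F; these classes are the elements of A^1.            *)
Definition divcl (a : {set E} -> int) : chow :=
  \sum_(F in G :\ setT) x_ F *~ a F.

End Chow.

(* The toric variety X over a field k of the nested-set fan is described on   *)
(* its affine charts U_S, one for each nested set S; the coordinate ring of   *)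
(* U_S is spanned by the characters in the dual cone.  The characters of the  *)
(* torus with cocharacter lattice N_E = Z^E / Z(1, ..., 1) are the m : E ->   *)
(* int with sum 0.  They are realized as Laurent monomials in the field of    *)
(* rational functions in variables indexed by E, an extension of the function *)
(* field of X in which all the coordinate rings live.                         *)

Section Torus.
Variables (k : fieldType) (E : finType).

Definition ratfun : fieldType := {fraction {mpoly k[#|E|]}}.

Definition character (m : {ffun E -> int}) : Prop := \sum_i m i = 0.

(* The pairing of m with the image v_F in N_E of the indicator vector of F.   *)
Definition pairing (m : {ffun E -> int}) (F : {set E}) : int :=
  \sum_(i in F) m i.

Definition chi (m : {ffun E -> int}) : ratfun :=
  \prod_(i : E) (FracField.tofrac ('X_(enum_rank i) : {mpoly k[#|E|]})) ^ m i.

Definition scalar (c : k) : ratfun := FracField.tofrac (c%:MP_[#|E|]).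

Definition char_span (Q : {ffun E -> int} -> Prop) (f : ratfun) : Prop :=
  exists2 s : seq (k * {ffun E -> int}),
    (forall cm, cm \in s -> character cm.2 /\ Q cm.2) &
    f = \sum_(cm <- s) scalar cm.1 * chi cm.2.

Definition chart_ring (S : {set {set E}}) : ratfun -> Prop :=
  char_span (fun m => forall F, F \in S -> 0 <= pairing m F).

End Torus.

Section Lattices.
Variables (L : fieldType).
Implicit Types (R : L -> Prop).

Definition lspan R (V : lmodType L) (X : V -> Prop) (v : V) : Prop :=
  exists2 s : seq (L * V),
    (forall p, p \in s -> R p.1 /\ X p.2) & v = \sum_(p <- s) p.1 *: p.2.

Definition submodule R (V : lmodType L) (P : V -> Prop) : Prop :=
  P 0 /\ forall a u v, R a -> P u -> P v -> P (a *: u + v).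

Definition localize (V : lmodType L) (x : L) (P : V -> Prop) (v : V) : Prop :=
  exists N : nat, P (x ^+ N *: v).

(* P is an R-submodule of L^n and Spec R is covered by finitely many basic    *)
(* open sets D(x) on which P is free with a basis that is a basis of L^n.     *)
Definition locally_free R n (P : 'rV[L]_n -> Prop) : Prop :=
  submodule R P /\
  exists2 s : seq L,
    (forall x, x \in s -> R x /\ x != 0) /\
    (exists2 c : L -> L, forall x, x \in s -> R (c x) & \sum_(x <- s) c x * x = 1) &
    forall x, x \in s -> exists2 g : 'M[L]_n, g \in unitmx &
      forall v, localize x P v <->
        exists2 u : 'rV[L]_n, forall j, localize (V := L^o) x R (u 0 j) & v = u *m g.

End Lattices.

Section Sheaves.
Variables (k : fieldType) (E : finType).
Local Notation L := (ratfun k E).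
Local Notation R := (@chart_ring k E).

(* A vector bundle of rank n on X, being torsion-free, embeds into its        *)
(* extension of scalars to L, a constant sheaf isomorphic to L^n.  It is      *)
(* encoded by its modules of sections over the charts U_S inside L^n; every   *)
(* morphism of bundles then extends uniquely to a matrix over L.              *)
Record sheaf := Sheaf {
  srk : nat;
  sec : {set {set E}} -> 'rV[L]_srk -> Prop }.

Definition dual_sheaf (P : sheaf) : sheaf :=
  @Sheaf (srk P) (fun S w => forall v, sec S v -> R S ((w *m v^T) 0 0)).

(* Rank-one sheaves, given by their sections in L. *)
Definition line := {set {set E}} -> L -> Prop.

Definition sheaf_of_line (l : line) : sheaf :=
  @Sheaf 1 (fun S v => l S (v 0 0)).

Definition line1 : line := R.

Definition line_tensor (l l' : line) : line := fun S =>
  lspan (V := L^o) (R S) (fun x => exists a b, [/\ l S a, l' S b & x = a * b]).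

Definition line_dual (l : line) : line := fun S f =>
  forall g, l S g -> R S (f * g).

Definition line_pow (l : line) (z : int) : line :=
  match z with
  | Posz n => iter n (line_tensor l) line1
  | Negz n => line_dual (iter n.+1 (line_tensor l) line1)
  end.

(* The top exterior power, inside the top exterior power L of L^n. *)
Definition det_sheaf (P : sheaf) : line := fun S =>
  lspan (V := L^o) (R S)
    (fun x => exists2 B : 'M[L]_(srk P), forall i, sec S (row i B) & x = \det B).

(* The sheaf O(D), D the sum of a F times the divisor of the ray of F. *)
Definition line_div (a : {set E} -> int) : line := fun S =>
  char_span (fun m => forall F, F \in S -> - a F <= pairing m F).

End Sheaves.

Definition subgroup_gen (V : zmodType) (X : V -> Prop) (v : V) : Prop :=
  forall J : V -> Prop, J 0 -> (forall x y, J x -> J y -> J (x - y)) ->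
    (forall y, X y -> J y) -> J v.

Section KTheory.
Variables (k : fieldType) (E : finType) (M : matroid E) (G : {set {set E}}).
Local Notation L := (ratfun k E).
Local Notation R := (@chart_ring k E).

Definition is_bundle (P : sheaf k E) : Prop :=
  (forall S, nested M G S -> locally_free (R S) (@sec _ _ P S)) /\
  (forall S S' : {set {set E}}, nested M G S' -> S \subset S' ->
     forall v, sec S v <-> lspan (R S) (@sec _ _ P S') v).

Definition bundle := {P : sheaf k E | is_bundle P}.

(* 0 -> P' -> P -> P'' -> 0 is exact on every chart, for the maps induced by  *)
(* the matrices A and B.                                                      *)
Definition short_exact (P' P P'' : sheaf k E) : Prop :=
  exists (A : 'M[L]_(srk P', srk P)) (B : 'M[L]_(srk P, srk P'')),
    forall S, nested M G S ->
      [/\ (forall u, sec (s := P') S u -> sec (s := P) S (u *m A)),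
          (forall u, sec (s := P') S u -> u *m A = 0 -> u = 0),
          (forall v, sec (s := P) S v -> sec (s := P'') S (v *m B)),
          (forall v, sec (s := P) S v ->
             v *m B = 0 <-> exists2 u, sec (s := P') S u & v = u *m A) &
          (forall w, sec (s := P'') S w ->
             exists2 v, sec (s := P) S v & w = v *m B)].

Definition bundle_group := {freeg {classic bundle} / int}.

Definition gen (P : {classic bundle}) : bundle_group := << P >>.

Variant K_rel : bundle_group -> Prop :=
| ExactRel (P' P P'' : bundle) of
    short_exact (sval P') (sval P) (sval P'') :
    K_rel (gen P - gen P' - gen P'').

Definition K_subgroup : {pred bundle_group} :=
  fun x => `[< subgroup_gen K_rel x >].

Lemma K_subgroup_closed : zmod_closed K_subgroup.
Proof.
split; first by apply/asboolP => J J0.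
move=> x y /asboolP hx /asboolP hy; apply/asboolP => J J0 JB JX.
exact: (JB _ _ (hx J J0 JB JX) (hy J J0 JB JX)).
Qed.

HB.instance Definition _ :=
  GRing.isZmodClosed.Build bundle_group K_subgroup K_subgroup_closed.

Definition K0 : zmodType := @Quotient.quot bundle_group K_subgroup.

Definition K_pi (x : bundle_group) : K0 := (\pi x)%qT.

(* The class of a vector bundle; 0 on sheaves that are not vector bundles.    *)
Definition K_class (P : sheaf k E) : K0 :=
  if pselect (is_bundle P) is left h then K_pi (gen (exist _ P h)) else 0.

Definition K_dual (xi : K0) : K0 :=
  \sum_(P <- dom (repr xi)) K_class (dual_sheaf (sval P)) *~ coeff P (repr xi).

(* The determinant line bundle, computed on a representative of xi. *)
Definition K_det (xi : K0) : line k E :=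
  \big[@line_tensor k E/@line1 k E]_(P <- dom (repr xi))
    line_pow (det_sheaf (sval P)) (coeff P (repr xi)).

Definition line_iso (l l' : line k E) : Prop :=
  exists2 f : L, f != 0 &
    forall S, nested M G S -> forall x, l S x <-> l' S (f * x).

(* The line bundle of a class in A^1, computed on a divisor of that class.    *)
Definition line_of (D : chow M G) : line k E :=
  line_div (some_st (fun _ => 0) (fun a => D = divcl M G a)).

Definition O_ (D : chow M G) : K0 := K_class (sheaf_of_line (line_of D)).

(* The first Chern class of xi is that of det xi, and c_1(O(D)) = D.          *)
Definition c1 (xi : K0) : chow M G :=
  some_st 0 (fun D =>
    exists2 a, D = divcl M G a & line_iso (line_div a) (K_det xi)).

Definition theta (i : E) (F : {set E}) : chow M G :=
  alpha M G i - \sum_(H in G :\ setT | F \subset H) x_ M G H.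

Definition tangent (i : E) : K0 :=
  O_ (alpha M G i) *+ M setT - K_class (sheaf_of_line (@line1 k E)) +
  \sum_(F in G :\ setT)
    (O_ (x_ M G F) - K_class (sheaf_of_line (@line1 k E)) +
     (O_ (theta i F) - O_ (theta i F + x_ M G F)) *+ M F).

Definition canonical_class (i : E) : chow M G := - c1 (tangent i).

End KTheory.

Section Pullback.
Variables (E : finType) (M : matroid E) (G G' : {set {set E}}).

Definition in_cone (S : {set {set E}}) (H : {set E}) : Prop :=
  exists (c : {set E} -> rat) (d : rat), (forall F, F \in S -> 0 <= c F) /\
    forall i : E, \sum_(F in S) c F * (i \in F)%:R = (i \in H)%:R + d.

(* The rational function chi m is a local equation on U_S of the divisor      *)
(* with multiplicities a.                                                     *)
Definition local_equation (a : {set E} -> int) (S : {set {set E}})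
    (m : {ffun E -> int}) : Prop :=
  character m /\ forall F, F \in S -> pairing m F = a F.

(* Let the fan of (M, G') refine that of (M, G).  The divisor b on the former *)
(* is the pullback of the divisor a on the latter: if the ray of H lies in    *)
(* the cone of S, then the generic point of the divisor of H maps to U_S, and *)
(* b has there the same local equation as a.                                  *)
Definition div_pullback (a b : {set E} -> int) : Prop :=
  forall H, H \in G' :\ setT -> forall S, nested M G S -> in_cone S H ->
  forall m, local_equation a S m -> b H = pairing m H.

Definition pullback (D : chow M G) : chow M G' :=
  some_st 0 (fun D' => exists a b,
    [/\ D = divcl M G a, D' = divcl M G' b & div_pullback a b]).

End Pullback.

(* Main.v *)
From HB Require Import structures.
From mathcomp Require Import all_boot all_order all_algebra.
From mathcomp Require Import ring zify boolp.
From mathcomp Require Import freeg mpoly.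
Require Import Defs.

Set Implicit Arguments.
Unset Strict Implicit.
Unset Printing Implicit Defensive.

Import Order.TTheory GRing.Theory Num.Theory.
Local Open Scope ring_scope.

(* The top exterior power of a bundle is, on each chart, an invertible        *)
(* fractional ideal of the coordinate ring, and a short exact sequence        *)
(* P' -> P -> P'' gives det P = f . det P' . det P'' with one rational        *)
(* function f for all charts.  So det induces a homomorphism from K_0 to the  *)
(* families of invertible fractional ideals modulo the global principal ones. *)
(* Nested sets are unimodular: a linear system prescribing pairings with the  *)
(* v_F is triangular after choosing in every member a point outside the       *)
(* smaller members.  Hence O(D) is principal on each chart, and since the     *)
(* units of the torus are the monomials and the degree one part of the Chow   *)
(* ideal is spanned by the linear relations, the isomorphism class of O(D)    *)
(* and D in A^1 determine each other.  This computes c_1 additively: each     *)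
(* difference [O(theta_F)] - [O(theta_F + x_F)] contributes -x_F.             *)
(* For the blow-up formula, F is the disjoint union of its factors F_j and    *)
(* rk F is the sum of the rk F_j, so that pulling back the divisor with       *)
(* multiplicities - r [i in H] + rk H - 1 gives multiplicity                  *)
(* - r [i in F] + rk F - l along the exceptional divisor.                     *)

(** * Localization of modules over a subring of a field *)

(** The first Chern class of a K-class is read off its determinant line bundle, so everything rests
    on the additivity of determinants. For an exact sequence with maps [A] and [B], choose a
    splitting [h0] of [B] over the function field. On every chart, local bases then compare through
    a block triangular matrix, and the single function [\det (col_mx A h0)] carries the product of
    the outer determinants to the middle one ([exact_det], [det_exact]). Hence [pic] is a
    homomorphism from [K0] to [Pic], and it turns duals into negatives ([det_dual], [pic_dual]).

    On line bundles of divisors this homomorphism loses nothing: O(D) and O(D') are isomorphic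
    exactly when D and D' agree in A^1 ([eq_linear_equivalent]). One side of this is the description
    of units on the torus ([torus_unit]) and of local generators by unimodularity
    ([exists_local_equation]); the other is the degree one part of the Chow ideal ([divcl_eqP]). As
    a result the choices hidden in [line_of], [c1] and [pullback] do not matter.

    The class of the tangent class is then a sum of divisors. In each summand the theta terms cancel
    and leave x_F - rk(F) x_F, which gives [canonical_classE]; [canonical_line_iso] is the same
    computation with the sign moved to the dual.

    For the blow-up, v_F is the sum of the v_K over the factors K of F, because these are disjoint
    with union F ([Fac_disjoint], [cover_Fac]). Pulling back therefore adds multiplicities over the
    factors ([pullback_divcl]). The canonical multiplicity is a part additive over the factors, by
    [rk_Fac], minus the constant 1; this constant is subtracted l times in the pullback and once
    upstairs, whence the coefficient l - 1 ([canonical_div_blowup]). *)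

Section Modules.
Variable L : fieldType.
Implicit Types (R : L -> Prop) (x y z : L).

Definition subring R : Prop :=
  [/\ R 1, forall a b, R a -> R b -> R (a - b) & forall a b, R a -> R b -> R (a * b)].

Lemma scale_reg (a u : L) : a *: (u : L^o) = a * u. Proof. by []. Qed.

Section Subring.
Variables (R : L -> Prop) (hR : subring R).

Lemma subring1 : R 1. Proof. by case: hR. Qed.
Lemma subringB a b : R a -> R b -> R (a - b). Proof. by case: hR => _ h _; apply: h. Qed.
Lemma subringM a b : R a -> R b -> R (a * b). Proof. by case: hR => _ _ h; apply: h. Qed.
Lemma subring0 : R 0. Proof. by rewrite -(subrr 1); apply: subringB; apply: subring1. Qed.
Lemma subringN a : R a -> R (- a).
Proof. by move=> Ra; rewrite -sub0r; apply: subringB => //; apply: subring0. Qed.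
Lemma subringD a b : R a -> R b -> R (a + b).
Proof. by move=> Ra Rb; rewrite -[b]opprK; apply: subringB => //; apply: subringN. Qed.
Lemma subringX a n : R a -> R (a ^+ n).
Proof.
move=> Ra; elim: n => [|n IHn]; first by rewrite expr0; apply: subring1.
by rewrite exprS; apply: subringM.
Qed.
Lemma subring_sum (I : Type) (r : seq I) (P : pred I) (F : I -> L) :
  (forall i, P i -> R (F i)) -> R (\sum_(i <- r | P i) F i).
Proof. by move=> h; apply: (big_ind R) => //; [apply: subring0 | apply: subringD]. Qed.
Lemma subring_prod (I : Type) (r : seq I) (P : pred I) (F : I -> L) :
  (forall i, P i -> R (F i)) -> R (\prod_(i <- r | P i) F i).
Proof. by move=> h; apply: (big_ind R) => //; [apply: subring1 | apply: subringM]. Qed.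
Lemma subring_det n (A : 'M[L]_n) : (forall i j, R (A i j)) -> R (\det A).
Proof.
move=> h; apply: subring_sum => s _; apply: subringM; last exact: subring_prod.
by apply: subringX; apply/subringN/subring1.
Qed.

Lemma submodule_self : submodule (V := L^o) R R.
Proof. by split=> [|a u v Ra Ru Rv]; [exact: subring0 | apply/subringD/Rv/subringM]. Qed.

Section Submodule.
Variables (V : lmodType L) (P : V -> Prop) (hP : submodule R P).

Lemma submodD u v : P u -> P v -> P (u + v).
Proof. by case: hP => _ h Pu Pv; rewrite -[u]scale1r; apply: h => //; apply: subring1. Qed.
Lemma submodZ a v : R a -> P v -> P (a *: v).
Proof. by case: hP => h0 h Ra Pv; rewrite -[_ *: _]addr0; apply: h. Qed.
Lemma submod_sum (I : Type) (r : seq I) (Q : pred I) (F : I -> V) :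
  (forall i, Q i -> P (F i)) -> P (\sum_(i <- r | Q i) F i).
Proof. by move=> h; apply: (big_ind P) => //; [case: hP | apply: submodD]. Qed.

Lemma localize_mono x v N N' : R x -> (N <= N')%N -> P (x ^+ N *: v) -> P (x ^+ N' *: v).
Proof.
move=> Rx le Pv; rewrite -(subnK le) exprD -scalerA.
by apply: submodZ => //; apply: subringX.
Qed.

Lemma localize_self x v : P v -> localize x P v.
Proof. by move=> Pv; exists 0%N; rewrite expr0 scale1r. Qed.

Lemma localize_submod x : R x ->
  submodule (localize (V := L^o) x R) (localize x P).
Proof.
move=> Rx; split=> [|a u v [N Na] [N' Pu] [K Pv]].
  by apply: localize_self; case: hP.
exists (N + N' + K)%N; rewrite scalerDr; apply: submodD.
  rewrite addnC exprD -scalerA; apply: submodZ; first exact: subringX.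
  by rewrite scalerA exprD mulrAC -scalerA; apply: submodZ.
by apply: localize_mono Pv => //; rewrite leq_addl.
Qed.

Definition covers (s : seq L) : Prop :=
  (forall x, x \in s -> R x /\ x != 0) /\
  (exists2 c : L -> L, forall x, x \in s -> R (c x) & \sum_(x <- s) c x * x = 1).

(* The elements of R with a power multiplying v into P form an ideal. *)
Lemma cover_local s v : covers s -> (forall x, x \in s -> localize x P v) -> P v.
Proof.
case=> hs [c Rc c1] loc.
pose I a := R a /\ localize a P v.
have I0 : I 0.
  split; first exact: subring0.
  by exists 1%N; rewrite expr1 scale0r; case: hP.
have ID a b : I a -> I b -> I (a + b).
  case=> Ra [N Pa] [Rb [K Pb]]; split; first exact: subringD.
  (* Every term of the binomial expansion contains [b] to a power at least [K] or [a] to a power at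
     least [N]. *)
  exists (N + K)%N; rewrite exprDn scaler_suml; apply: submod_sum => i _.
  rewrite -mulr_natl -scalerA; apply: submodZ.
    by rewrite -(card_ord 'C(N + K, i)) -sumr_const; apply: subring_sum => *; apply: subring1.
  have [leKi|ltiK] := leqP K i.
    rewrite -scalerA; apply: submodZ; first exact: subringX.
    exact: localize_mono Pb.
  rewrite mulrC -scalerA; apply: submodZ; first exact: subringX.
  by apply: localize_mono Pa => //; rewrite -addnBA ?leq_addr // ltnW.
have IM a b : R a -> I b -> I (a * b).
  move=> Ra [Rb [N Pb]]; split; first exact: subringM.
  by exists N; rewrite exprMn -scalerA; apply: submodZ => //; apply: subringX.
suff [_ [N]] : I 1 by rewrite expr1n scale1r.
rewrite -c1 big_seq; apply: (big_ind I) => // x xs.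
by apply: IM; [apply: Rc | split; [case: (hs x xs) | apply: loc]].
Qed.

End Submodule.

Lemma localize_subring x : R x -> x != 0 -> subring (localize (V := L^o) x R).
Proof.
move=> Rx x0.
split.
- by apply: localize_self; apply: subring1.
- move=> a b [N Ra] [K Rb]; exists (maxn N K); rewrite scalerBr; apply: subringB.
    by apply: (localize_mono submodule_self) Ra; rewrite // leq_maxl.
  by apply: (localize_mono submodule_self) Rb; rewrite // leq_maxr.
- move=> a b [N Ra] [K Rb]; exists (N + K)%N.
  by rewrite exprD /GRing.scale /= mulrACA; apply: subringM.
Qed.

Lemma localize_expV x N : R x -> x != 0 -> localize (V := L^o) x R (x ^- N).
Proof.
by move=> Rx x0; exists N; rewrite /GRing.scale /= divff ?expf_neq0 //; apply: subring1.
Qed.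

Lemma localize_divX (V : lmodType L) (P : V -> Prop) x v N : submodule R P ->
  R x -> x != 0 -> localize x P (x ^+ N *: v) <-> localize x P v.
Proof.
move=> hP Rx x0; split=> [[K PK]|[K PK]].
  by exists (K + N)%N; rewrite exprD -scalerA.
exists K; rewrite scalerA mulrC -scalerA; apply: submodZ => //; exact: subringX.
Qed.

Lemma localizeM (V : lmodType L) (P : V -> Prop) x y v : submodule R P ->
  R y -> localize x P v -> localize (x * y) P v.
Proof.
move=> hP Ry [N Pv]; exists N; rewrite exprMn mulrC -scalerA.
by apply: submodZ => //; apply: subringX.
Qed.

Lemma localize_submodR (V : lmodType L) (P : V -> Prop) x : submodule R P -> R x ->
  submodule R (localize x P).
Proof.
move=> hP Rx; split=> [|a u w Ra]; first by apply: localize_self; case: hP.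
by apply: (localize_submod hP Rx).2; apply: localize_self.
Qed.

Lemma localize_localize (V : lmodType L) (P : V -> Prop) x y v :
  localize (x * y) P v -> localize y (localize x P) v.
Proof. by case=> N PN; exists N; exists N; rewrite scalerA -exprMn. Qed.

(** The three modules of a short exact sequence become free on three different covers; the products
    of their members form a common refinement. *)
Lemma cover_local3 (V : lmodType L) (P : V -> Prop) s t r v : submodule R P ->
  covers s -> covers t -> covers r ->
  (forall x y z, x \in s -> y \in t -> z \in r -> localize (x * y * z) P v) -> P v.
Proof.
move=> hP hs ht hr loc; apply: (cover_local hP hs) => x xs.
have [Rx x0] := hs.1 x xs; have hx := localize_submodR hP Rx.
apply: (cover_local hx ht) => y yt; have [Ry y0] := ht.1 y yt.
apply: (cover_local (localize_submodR hx Ry) hr) => z zr.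
apply/localize_localize; have [N PN] := loc x y z xs yt zr.
by exists N; exists N; rewrite scalerA -exprMn mulrA.
Qed.

Section Span.
Variables (V : lmodType L) (X : V -> Prop).

Lemma lspan_submod : submodule R (lspan R X).
Proof.
split=> [|a u v Ra [s hs ->] [t ht ->]]; first by exists [::]; rewrite ?big_nil.
exists ([seq (a * p.1, p.2) | p <- s] ++ t).
  move=> p; rewrite mem_cat => /orP[/mapP[q qs ->]|/ht//].
  by case: (hs q qs) => Rq Xq; split => //; apply: subringM.
rewrite big_cat big_map scaler_sumr; congr (_ + _).
by apply: eq_bigr => p _; rewrite scalerA.
Qed.

Lemma lspan_gen v : X v -> lspan R X v.
Proof.
move=> Xv; exists [:: (1, v)]; last by rewrite big_seq1 scale1r.
by move=> p; rewrite inE => /eqP->; split => //; apply: subring1.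
Qed.

Lemma lspan_min (P : V -> Prop) : submodule R P -> (forall v, X v -> P v) ->
  forall v, lspan R X v -> P v.
Proof.
move=> hP XP _ [s hs ->]; rewrite big_seq; apply: submod_sum => // p ps.
by have [Rp Xp] := hs p ps; apply: submodZ => //; apply: XP.
Qed.
End Span.

Definition free_on n (P : 'rV[L]_n -> Prop) (g : 'M[L]_n) : Prop :=
  g \in unitmx /\
  forall v, P v <-> exists2 u : 'rV[L]_n, forall j, R (u 0 j) & v = u *m g.

Lemma free_on_row n (P : 'rV[L]_n -> Prop) g i : free_on P g -> P (row i g).
Proof.
case=> _ hP; apply/hP; exists (delta_mx 0 i); last by rewrite -rowE.
by move=> j; rewrite mxE; case: (_ && _); [apply: subring1 | apply: subring0].
Qed.

Lemma free_on_mx m n (P : 'rV[L]_n -> Prop) g (B : 'M[L]_(m, n)) : free_on P g ->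
  (forall i, P (row i B)) -> exists2 U : 'M[L]_(m, n), forall i j, R (U i j) & B = U *m g.
Proof.
move=> [gU hP] PB; exists (B *m invmx g); last by rewrite mulmxKV.
move=> i j; have /hP[u Ru eu] := PB i.
suff <- : u 0 j = (B *m invmx g) i j by [].
by rewrite -[u](mulmxK gU) -eu -row_mul mxE.
Qed.

End Subring.

(** A basis over D(x) remains one over the smaller open set D(xy): a power of [y] moves a vector
    into the module over D(x), and it is invertible over D(xy). *)
Lemma free_onM R n (P : 'rV[L]_n -> Prop) g x y :
  subring R -> submodule R P -> R x -> R y -> x != 0 -> y != 0 ->
  free_on (localize (V := L^o) x R) (localize x P) g ->
  free_on (localize (V := L^o) (x * y) R) (localize (x * y) P) g.
Proof.
move=> hR hP Rx Ry x0 y0 fr; have [gU hg] := fr; split => // v.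
have Rxy := subringM hR Rx Ry; have xy0 : x * y != 0 by rewrite mulf_neq0.
split=> [[N Pv]|[u Ru ->]].
  have /hg[u Ru eu] : localize x P (y ^+ N *: v).
    by exists N; rewrite scalerA -exprMn.
  exists (y ^- N *: u); last first.
    by rewrite -scalemxAl -eu scalerA mulVf ?scale1r // expf_neq0.
  move=> j; rewrite mxE; apply: (subringM (localize_subring hR Rxy xy0)).
    rewrite mulrC; apply: (localizeM hR (submodule_self hR)) => //; exact: localize_expV.
  exact: (localizeM hR (submodule_self hR)).
have hl := localize_submod hR hP Rxy.
have hRl := localize_subring hR Rxy xy0.
rewrite mulmx_sum_row; apply: (submod_sum hRl hl) => i _.
apply: (submodZ hl); first exact: Ru.
apply: (localizeM hR hP) => //.
exact: (free_on_row (localize_subring hR Rx x0) i fr).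
Qed.

(** * Fractional ideals and top exterior powers *)

Section Ideals.
Variables (R : L -> Prop) (hR : subring R).
Implicit Types (I J : L -> Prop).

Local Notation loc x I := (localize (V := L^o) x I).

Definition ideal_mul I J : L -> Prop :=
  lspan (V := L^o) R (fun x => exists a b, [/\ I a, J b & x = a * b]).

Definition ideal_dual I : L -> Prop := fun f => forall g, I g -> R (f * g).

(** The rank one case of [free_on], stated without matrices; see [principal_at_free]. *)
Definition principal_at x I (d : L) : Prop :=
  d != 0 /\ forall v : L, loc x I v <-> loc x R (v / d).

Lemma ideal_mul_submod I J : submodule (V := L^o) R (ideal_mul I J).
Proof. exact: lspan_submod. Qed.

Lemma ideal_dual_submod I : submodule (V := L^o) R (ideal_dual I).
Proof.
split=> [g _|a u v Ra hu hv g Ig]; first by rewrite mul0r; apply: subring0.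
rewrite mulrDl scale_reg -mulrA; apply: subringD => //; last exact: hv.
by apply: subringM => //; apply: hu.
Qed.

Lemma principal_at_mul x I J d e : R x -> x != 0 ->
  principal_at x I d -> principal_at x J e -> principal_at x (ideal_mul I J) (d * e).
Proof.
move=> Rx x0 [d0 hI] [e0 hJ]; split; first by rewrite mulf_neq0.
have hRl := localize_subring hR Rx x0.
move=> v; split=> [[N]|[N RN]].
  pose Q (u : L^o) := loc x R (u / (d * e)).
  have hQ : submodule R Q.
    split; first by rewrite /Q mul0r; apply: subring0.
    move=> a u w Ra Qu Qw; rewrite /Q mulrDl -scalerAl; apply: subringD => //.
    by apply: subringM => //; apply: localize_self.
  move/(lspan_min hR hQ) => h.
  have {h} : Q (x ^+ N *: (v : L^o)).
    apply: h => _ [a [b [Ia Jb ->]]]; rewrite /Q invfM mulrACA.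
    by apply: subringM => //; [apply/hI | apply/hJ]; apply: localize_self.
  rewrite /Q scale_reg -mulrA => /(localize_divX hR _ _ (submodule_self hR) Rx x0); exact.
(* The generators lie only in the localized ideals; the exponents [K] and [K'] bring them back into
   [I] and [J]. *)
have [K IK] : loc x I d by apply/hI; rewrite divff //; apply: subring1.
have [K' JK] : loc x J e by apply/hJ; rewrite divff //; apply: subring1.
exists (N + (K + K'))%N.
have -> : x ^+ (N + (K + K')) *: (v : L^o) =
    (x ^+ N *: (v / (d * e) : L^o)) *: (((x ^+ K *: (d : L^o)) * (x ^+ K' *: (e : L^o))) : L^o).
  by rewrite !scale_reg !exprD; field; rewrite d0 e0.
apply: (submodZ (ideal_mul_submod I J)); first exact: RN.
by apply: (lspan_gen hR); exists (x ^+ K *: (d : L^o)), (x ^+ K' *: (e : L^o)).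
Qed.

Lemma principal_at_eq x I J d e v : R x -> x != 0 ->
  principal_at x I d -> principal_at x J e -> loc x R (d / e) ->
  loc x I v -> loc x J v.
Proof.
move=> Rx x0 [d0 hI] [e0 hJ] de /hI vd; apply/hJ.
rewrite -[v](divfK d0) -(mulrA (v / d)).
exact: (subringM (localize_subring hR Rx x0)).
Qed.

Lemma principal_at_scale x I d f : f != 0 ->
  principal_at x I d -> principal_at x (fun v => I (v / f)) (f * d).
Proof.
move=> f0 [d0 hI]; split; first by rewrite mulf_neq0.
move=> v; rewrite invfM mulrA; split=> [[N IN]|/hI[N IN]].
  by apply/hI; exists N; rewrite scale_reg mulrA.
by exists N; rewrite scale_reg -mulrA.
Qed.

Lemma principal_at_free x I d :
  principal_at x I d <->
  free_on (loc x R) (localize x (fun v : 'rV[L]_1 => I (v 0 0))) d%:M /\ d != 0.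
Proof.
have locE (v : 'rV[L]_1) : localize x (fun v : 'rV[L]_1 => I (v 0 0)) v <-> loc x I (v 0 0).
  by split=> -[N IN]; exists N; rewrite ?mxE in IN *.
split=> [[d0 hI]|[[gU hg] d0]].
  split => //; split; first by rewrite unitmxE det_scalar1 unitfE.
  move=> v; rewrite locE; split=> [/hI vd|[u Ru ->]].
    exists (v 0 0 / d)%:M; first by move=> j; rewrite ord1 mxE eqxx.
    by apply/rowP=> j; rewrite ord1 mul_scalar_mx !mxE eqxx divfK.
  by apply/hI; rewrite mul_mx_scalar mxE mulrC mulKf.
split => // v.
have := hg v%:M; rewrite locE mxE eqxx mulr1n => ->; split=> [[u Ru]|Rv].
  by move/rowP/(_ 0); rewrite mul_mx_scalar !mxE eqxx mulr1n => ->; rewrite mulrC mulKf.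
exists (v / d)%:M; first by move=> j; rewrite ord1 mxE eqxx.
by apply/rowP=> j; rewrite ord1 mul_scalar_mx !mxE eqxx divfK.
Qed.

(** Clearing denominators gives an exponent for each generator; for finitely many generators the
    largest one serves for all. *)
Lemma exists_uniform_exponent (T : eqType) (r : seq T) (Q : T -> nat -> Prop) :
  (forall t N N', (N <= N')%N -> Q t N -> Q t N') ->
  (forall t, t \in r -> exists N, Q t N) -> exists N, forall t, t \in r -> Q t N.
Proof.
move=> mono; elim: r => [|t r IHr] h; first by exists 0%N.
have [N QN] := h t (mem_head _ _).
have [|K QK] := IHr; first by move=> u ur; apply: h; rewrite inE ur orbT.
exists (maxn N K) => u; rewrite inE => /orP[/eqP->|ur].
  by apply: mono QN; rewrite leq_maxl.
by apply: mono (QK u ur); rewrite leq_maxr.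
Qed.

Definition det_ideal n (P : 'rV[L]_n -> Prop) : L -> Prop :=
  lspan (V := L^o) R (fun x => exists2 B : 'M[L]_n, forall i, P (row i B) & x = \det B).

Lemma free_on_rows x n (P : 'rV[L]_n -> Prop) g : submodule R P -> R x -> x != 0 ->
  free_on (loc x R) (localize x P) g -> exists N, forall i, P (x ^+ N *: row i g).
Proof.
move=> hP Rx x0 fr.
have [t N N' le h|t _|N hN] := @exists_uniform_exponent 'I_n (enum 'I_n)
  (fun i N => P (x ^+ N *: row i g)).
- exact: (localize_mono hR hP Rx le h).
- exact: (free_on_row (localize_subring hR Rx x0) t fr).
- by exists N => i; apply: hN; rewrite mem_enum.
Qed.

(** A matrix with rows in [P] is [U *m g] with [U] over the localized ring, so its determinant is a
    multiple of [\det g]. Conversely, some [x ^+ N *: g] has its rows in [P]. *)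
Lemma det_principal_at x n (P : 'rV[L]_n -> Prop) g : submodule R P -> R x -> x != 0 ->
  free_on (loc x R) (localize x P) g -> principal_at x (det_ideal P) (\det g).
Proof.
move=> hP Rx x0 fr; have [gU hg] := fr.
have d0 : \det g != 0 by rewrite -unitfE -unitmxE.
have hRl := localize_subring hR Rx x0.
split=> // v; split=> [[N]|[K RK]].
  pose Q (u : L^o) := loc x R (u / \det g).
  have hQ : submodule R Q.
    split; first by rewrite /Q mul0r; apply: subring0.
    move=> a u w Ra Qu Qw; rewrite /Q mulrDl -scalerAl; apply: subringD => //.
    by apply: subringM => //; apply: localize_self.
  move/(lspan_min hR hQ) => h.
  have {h} : Q (x ^+ N *: (v : L^o)).
    apply: h => _ [B PB ->].
    have [i|U RU ->] := free_on_mx (B := B) fr; first exact/localize_self/PB.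
    by rewrite /Q det_mulmx mulfK //; apply: subring_det.
  rewrite /Q scale_reg -mulrA => /(localize_divX hR _ _ (submodule_self hR) Rx x0); exact.
have [N PN] := free_on_rows hP Rx x0 fr.
(* Scaling all [n] rows of [g] by [x ^+ N] multiplies the determinant by [x ^+ (N * n)]. *)
exists (K + N * n)%N.
have -> : x ^+ (K + N * n) *: (v : L^o) =
   (x ^+ K *: (v / \det g : L^o)) *: (\det (x ^+ N *: g) : L^o).
  by rewrite detZ -exprM !scale_reg exprD; field.
apply: (submodZ (lspan_submod hR _)); first exact: RK.
by apply: (lspan_gen hR); exists (x ^+ N *: g) => // i; rewrite linearZ; apply: PN.
Qed.

End Ideals.
End Modules.

(** * Duals and determinants of locally free modules *)

Section Bundles.
Variable L : fieldType.
Implicit Types (R : L -> Prop).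

Local Notation loc x I := (localize (V := L^o) x I).
Local Notation dot w v := ((w *m v^T) 0 0).

Lemma locally_freeP R n (P : 'rV[L]_n -> Prop) :
  locally_free R P <-> submodule R P /\ exists2 s, covers R s &
    forall x, x \in s -> exists g, free_on (loc x R) (localize x P) g.
Proof.
split=> -[hP [s hs fr]]; split=> //; exists s => // x xs.
  by have [g gU hg] := fr x xs; exists g; split.
by have [g [gU hg]] := fr x xs; exists g.
Qed.

Lemma dotE n (w v : 'rV[L]_n) : dot w v = \sum_j w 0 j * v 0 j.
Proof. by rewrite mxE; apply: eq_bigr => j _; rewrite mxE. Qed.

Lemma dotZl n a (w v : 'rV[L]_n) : dot (a *: w) v = a * dot w v.
Proof. by rewrite -scalemxAl mxE. Qed.

Lemma dotZr n a (w v : 'rV[L]_n) : dot w (a *: v) = a * dot w v.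
Proof. by rewrite linearZ /= -scalemxAr mxE. Qed.

Lemma dotDl n (w w' v : 'rV[L]_n) : dot (w + w') v = dot w v + dot w' v.
Proof. by rewrite mulmxDl mxE. Qed.

Lemma dot_sumr n (I : Type) (r : seq I) (w : 'rV[L]_n) (F : I -> 'rV[L]_n) :
  dot w (\sum_(i <- r) F i) = \sum_(i <- r) dot w (F i).
Proof. by rewrite linear_sum /= mulmx_sumr summxE. Qed.

Lemma dot_row n m (w : 'rV[L]_n) (g : 'M[L]_(m, n)) j : dot w (row j g) = (w *m g^T) 0 j.
Proof. by rewrite dotE mxE; apply: eq_bigr => i _; rewrite !mxE. Qed.

Lemma dual_basisE n (w : 'rV[L]_n) (g : 'M[L]_n) : g \in unitmx ->
  w = \sum_j dot w (row j g) *: row j (invmx g)^T.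
Proof.
move=> gU; have gTU : g^T \in unitmx by rewrite unitmx_tr.
rewrite -[LHS](mulmxK gTU) mulmx_sum_row.
by apply: eq_bigr => j _; rewrite dot_row trmx_inv.
Qed.

Section Dual.
Variables (R : L -> Prop) (hR : subring R) (n : nat) (P : 'rV[L]_n -> Prop).
Hypothesis hP : submodule R P.

(** Ring and module are both arguments, so that duals over two charts can be compared in
    [dual_mod_lspan]. *)
Definition dual_mod (R' : L -> Prop) (P' : 'rV[L]_n -> Prop) : 'rV[L]_n -> Prop :=
  fun w => forall v, P' v -> R' (dot w v).

Lemma dual_mod_submod : submodule R (dual_mod R P).
Proof.
split=> [v _|a u w Ra hu hw v Pv]; first by rewrite mul0mx mxE; apply: subring0.
rewrite dotDl dotZl; apply: subringD => //; last exact: hw.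
by apply: subringM => //; apply: hu.
Qed.

(** Dualizing commutes with localization because [P] is finitely generated on each piece of a finite
    cover: one power of [x] clears the denominators of a functional on all the generators, hence on
    [P]. The local basis of the dual is then the basis dual to the rows of [g]. *)
Lemma dual_free_on s x g : covers R s ->
  (forall y, y \in s -> exists g, free_on (loc y R) (localize y P) g) ->
  R x -> x != 0 -> free_on (loc x R) (localize x P) g ->
  free_on (loc x R) (localize x (dual_mod R P)) (invmx g)^T.
Proof.
move=> hs fr Rx x0 frx; have [gU hg] := frx.
have hRx := localize_subring hR Rx x0.
split=> [|w]; first by rewrite unitmx_tr unitmx_inv.
split=> [[N hw]|[u Ru ->]].
  exists (w *m g^T); last by rewrite trmx_inv mulmxK // unitmx_tr.
  move=> j; rewrite -dot_row; have [M PM] := free_on_rows hR hP Rx x0 frx.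
  by exists (N + M)%N; rewrite scale_reg exprD -mulrA -dotZr -dotZl; apply: hw.
(* [Q y N]: after multiplication by [x ^+ N] the functional has values without denominator [x] on
   the part of [P] over D(y). One [N] for all [y] in the cover is what is needed. *)
pose Q (y : L) N := forall v, localize y P v -> loc y R (dot (x ^+ N *: (u *m (invmx g)^T)) v).
have dotu v : P v -> loc x R (dot (u *m (invmx g)^T) v).
  move=> Pv; have /hg[u' Ru' ->] : localize x P v by apply: localize_self.
  rewrite -mulmxA -trmx_mul mulmxK // dotE; apply: subring_sum => // j _.
  exact: (subringM hRx).
have QM y N N' : (N <= N')%N -> y \in s -> Q y N -> Q y N'.
  move=> le ys QN v Pv; rewrite dotZl.
  have [Ry y0] := hs.1 y ys; have := QN v Pv; rewrite dotZl => -[K RK].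
  exists K; rewrite -(subnK le) exprD !scale_reg in RK *.
  by rewrite -mulrA mulrCA; apply: (subringM hR) => //; apply: subringX.
have [N QN] : exists N, forall y, y \in s -> Q y N.
  have [y N N' le QN ys|y ys|N QN] :=
      @exists_uniform_exponent _ s (fun y N => y \in s -> Q y N);
    last by exists N => y ys; apply: QN.
    exact: QM le ys (QN ys).
  have [Ry y0] := hs.1 y ys; have [gy fry] := fr y ys.
  have hRy := localize_subring hR Ry y0.
  have [M PM] := free_on_rows hR hP Ry y0 fry.
  have [j N N' le|j _|N hN] := @exists_uniform_exponent 'I_n (enum 'I_n)
     (fun j N => R (x ^+ N * dot (u *m (invmx g)^T) (y ^+ M *: row j gy))).
  - exact: (localize_mono (V := L^o) hR (submodule_self hR) Rx le).
  - by have [N RN] := dotu _ (PM j); exists N.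
  exists N => _ v /fry.2[u' Ru' ->].
  rewrite (mulmx_sum_row u') dot_sumr; apply: (subring_sum hRy) => j _.
  rewrite dotZr; apply: (subringM hRy) => //.
  exists M; rewrite scale_reg dotZl mulrCA -dotZr.
  by apply: hN; rewrite mem_enum.
exists N => v Pv.
apply: (cover_local (V := L^o) hR (submodule_self hR) hs) => y ys.
by apply: QN => //; apply: localize_self.
Qed.

Lemma dual_locally_free : locally_free R P -> locally_free R (dual_mod R P).
Proof.
move=> /locally_freeP[_ [s hs fr]]; apply/locally_freeP.
split; first exact: dual_mod_submod.
exists s => // x xs; have [Rx x0] := hs.1 x xs; have [g frx] := fr x xs.
by exists (invmx g)^T; apply: (dual_free_on hs).
Qed.

(** Duals commute with restriction to a smaller chart. Locally [w] is expanded in the dual basis: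
    its coefficients are values of [w] on [P], hence in [R'], and up to powers of [x] the dual basis
    already lies in the dual over [R]. *)
Lemma dual_mod_lspan R' : subring R' -> (forall a, R a -> R' a) -> locally_free R P ->
  forall w, dual_mod R' (lspan R' P) w <-> lspan R' (dual_mod R P) w.
Proof.
move=> hR' RR' /locally_freeP[_ [s hs fr]] w; split.
  move=> hw; have hsub := lspan_submod hR' (dual_mod R P).
  have hs' : covers R' s.
    case: hs => s1 [c Rc c1]; split=> [x /s1[/RR']//|].
    by exists c => // x /Rc/RR'.
  apply: (cover_local hR' hsub hs') => x xs.
  have [Rx x0] := hs.1 x xs; have [g frx] := fr x xs.
  have [gU _] := frx.
  have frd := dual_free_on hs fr Rx x0 frx.
  have [M PM] := free_on_rows hR hP Rx x0 frx.
  have [K PK] := free_on_rows hR dual_mod_submod Rx x0 frd.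
  rewrite (dual_basisE w gU).
  apply: (submod_sum hR' (localize_submodR hR' hsub (RR' _ Rx))) => j _.
  exists (M + K)%N; rewrite exprD scalerA mulrAC -scalerA.
  apply: (submodZ hsub); last exact/(lspan_gen hR')/PK.
  by rewrite -dotZr; apply: hw; apply/(lspan_gen hR')/PM.
move=> hw v hv; move: w hw.
apply: (lspan_min hR').
  split=> [|a u w Ra hu hw]; first by rewrite mul0mx mxE; apply: subring0.
  by rewrite dotDl dotZl; apply: subringD => //; apply: subringM.
move=> w hw; move: v hv; apply: (lspan_min hR'); last by move=> v /hw/RR'.
split=> [|a u v Ra hu hv]; first by rewrite trmx0 mulmx0 mxE; apply: subring0.
rewrite linearD /= mulmxDr mxE; apply: subringD => //.
by rewrite dotZr; apply: subringM.
Qed.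

End Dual.

Definition locally_principal R (I : L -> Prop) : Prop :=
  submodule (V := L^o) R I /\ exists2 s, covers R s &
    forall x, x \in s -> exists d, principal_at R x I d.

Lemma ideal_dual_principal_at R (I : L -> Prop) x d : subring R -> locally_principal R I ->
  R x -> x != 0 -> principal_at R x I d -> principal_at R x (ideal_dual R I) d^-1.
Proof.
move=> hR [hI [s hs pr]] Rx x0 prx; have d0 := prx.1.
apply/principal_at_free; split; last by rewrite invr_eq0.
have -> : d^-1%:M = (invmx d%:M)^T :> 'M[L]_1 by rewrite invmx_scalar tr_scalar_mx.
have hP : submodule R (fun v : 'rV[L]_1 => I (v 0 0)).
  by split=> [|a u v Ra Iu Iv]; rewrite !mxE; [case: hI | apply: hI.2].
have -> : (fun v : 'rV[L]_1 => ideal_dual R I (v 0 0)) =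
          dual_mod R (fun v : 'rV[L]_1 => I (v 0 0)).
  apply/funext => w; apply/propext; split=> hw v Iv.
    by rewrite dotE big_ord1; apply: hw.
  by have := hw v%:M; rewrite dotE big_ord1 !mxE eqxx mulr1n; apply.
apply: (dual_free_on hR hP hs _ Rx x0); last by case/principal_at_free: prx.
by move=> y ys; have [e /principal_at_free[fre _]] := pr y ys; exists e%:M.
Qed.

Lemma det_locally_principal R n (P : 'rV[L]_n -> Prop) :
  subring R -> locally_free R P -> locally_principal R (det_ideal R P).
Proof.
move=> hR /locally_freeP[hP [s hs fr]]; split; first exact: lspan_submod.
exists s => // x xs; have [Rx x0] := hs.1 x xs; have [g frx] := fr x xs.
by exists (\det g); apply: det_principal_at.
Qed.

(** Both sides are locally generated by the inverse of [\det g], since the dual basis has the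
    inverse transpose as its matrix. *)
Lemma det_dual R n (P : 'rV[L]_n -> Prop) v : subring R -> locally_free R P ->
  det_ideal R (dual_mod R P) v <-> ideal_dual R (det_ideal R P) v.
Proof.
move=> hR lf; have lp := det_locally_principal hR lf.
move: lf => /locally_freeP[hP [s hs fr]].
have loc1 x : x \in s -> exists d,
    principal_at R x (det_ideal R (dual_mod R P)) d /\
    principal_at R x (ideal_dual R (det_ideal R P)) d.
  move=> xs; have [Rx x0] := hs.1 x xs; have [g frx] := fr x xs.
  exists (\det g)^-1; split.
    rewrite -det_inv -det_tr; apply: det_principal_at => //.
      exact: dual_mod_submod.
    exact: (dual_free_on hR hP hs).
  by apply: ideal_dual_principal_at => //; apply: det_principal_at.
split=> hv.
  apply: (cover_local (V := L^o) hR (ideal_dual_submod hR _) hs) => x /loc1[d [h1 h2]].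
  by apply/h2.2/h1.2; apply: localize_self.
apply: (cover_local (V := L^o) hR (lspan_submod hR _) hs) => x /loc1[d [h1 h2]].
by apply/h1.2/h2.2; apply: localize_self.
Qed.

(** * Determinants along short exact sequences *)

Definition exact_on n' n n'' (P' : 'rV[L]_n' -> Prop) (P : 'rV[L]_n -> Prop)
    (P'' : 'rV[L]_n'' -> Prop) (A : 'M[L]_(n', n)) (B : 'M[L]_(n, n'')) : Prop :=
  [/\ forall u, P' u -> P (u *m A), forall u, P' u -> u *m A = 0 -> u = 0,
      forall v, P v -> P'' (v *m B),
      forall v, P v -> v *m B = 0 <-> exists2 u, P' u & v = u *m A &
      forall w, P'' w -> exists2 v, P v & w = v *m B].

Lemma localize_exact n' n n'' (P' : 'rV[L]_n' -> Prop) (P : 'rV[L]_n -> Prop)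
    (P'' : 'rV[L]_n'' -> Prop) A B x : x != 0 -> exact_on P' P P'' A B ->
  exact_on (localize x P') (localize x P) (localize x P'') A B.
Proof.
move=> x0 [hA inj hB ex sj].
have xK N m (v : 'rV[L]_m) : x ^- N *: (x ^+ N *: v) = v.
  by rewrite scalerA mulVf ?scale1r // expf_neq0.
have Kx N m (v : 'rV[L]_m) : x ^+ N *: (x ^- N *: v) = v.
  by rewrite scalerA divff ?scale1r // expf_neq0.
split.
- by move=> u [N Pu]; exists N; rewrite scalemxAl; apply: hA.
- move=> u [N Pu] uA; rewrite -[u](xK N) (inj _ Pu) ?scaler0 //.
  by rewrite -scalemxAl uA scaler0.
- by move=> v [N Pv]; exists N; rewrite scalemxAl; apply: hB.
- move=> v [N Pv]; split=> [vB|[u [K Pu] ->]].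
    have [u Pu eu] : exists2 u, P' u & x ^+ N *: v = u *m A.
      by apply/ex => //; rewrite -scalemxAl vB scaler0.
    exists (x ^- N *: u); first by exists N; rewrite Kx.
    by rewrite -scalemxAl -eu xK.
  have : (x ^+ K *: u) *m A *m B = 0 by apply/ex; [apply: hA | exists (x ^+ K *: u)].
  by rewrite -!scalemxAl => h; rewrite -[LHS](xK K) h scaler0.
- move=> w [N Pw]; have [v Pv ew] := sj _ Pw.
  exists (x ^- N *: v); first by exists N; rewrite Kx.
  by rewrite -scalemxAl -ew xK.
Qed.

Section Exact.
Variables (R : L -> Prop) (hR : subring R) (n' n n'' : nat).
Variables (P' : 'rV[L]_n' -> Prop) (P : 'rV[L]_n -> Prop) (P'' : 'rV[L]_n'' -> Prop).
Variables (g' : 'M[L]_n') (g : 'M[L]_n) (g'' : 'M[L]_n'').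
Variables (A : 'M[L]_(n', n)) (B : 'M[L]_(n, n'')).
Hypotheses (fr' : free_on R P' g') (fr : free_on R P g) (fr'' : free_on R P'' g'').
Hypothesis ex : exact_on P' P P'' A B.

(** Exactness speaks of sections only, but the rows of [g'] are sections and form a basis over the
    whole field. *)
Lemma exact_mul0 : A *m B = 0.
Proof.
have [hA _ _ hK _] := ex; have [gU' _] := fr'.
rewrite -[A *m B](mulKmx gU') [g' *m _]mulmxA; apply: (canLR (mulKmx gU')).
rewrite mulmx0; apply/row_matrixP => i; rewrite row0 !row_mul.
have Pi := free_on_row hR i fr'.
by apply/hK; [apply: hA | exists (row i g')].
Qed.

(* Lifting the basis of the quotient, one gets a second basis of the middle  *)
(* module; it differs from the first one by an invertible matrix over R.      *)
Lemma exact_basis : exists h : 'M[L]_(n'', n), exists D : 'M[L]_(n' + n'', n),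
  exists D' : 'M[L]_(n, n' + n''),
  [/\ h *m B = g'' /\ col_mx (g' *m A) h = D *m g,
      forall i j, R (D i j), forall i j, R (D' i j),
      D *m D' = 1%:M & D' *m D = 1%:M].
Proof.
have AB := exact_mul0; have [hA inj hB hK sj] := ex.
have [gU' _] := fr'; have [gU _] := fr; have [gU'' _] := fr''.
have /choice[h0 hh0] : forall i : 'I_n'', exists v, P v /\ row i g'' = v *m B.
  by move=> i; have [v Pv e] := sj _ (free_on_row hR i fr''); exists v.
pose h : 'M[L]_(n'', n) := \matrix_i h0 i.
have hhB : h *m B = g''.
  by apply/row_matrixP => i; rewrite row_mul rowK; case: (hh0 i).
pose C := col_mx (g' *m A) h.
have PC i : P (row i C).
  case: (split_ordP i) => j ->; rewrite ?rowKu ?rowKd; last by rewrite rowK; case: (hh0 j).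
  by rewrite row_mul; apply: hA; apply: (free_on_row hR).
have [D RD eD] := free_on_mx fr PC.
(* Subtracting a lift of the image of [v] leaves a vector in the kernel, which comes from [P']. *)
have genC v : P v -> exists w : 'rV_(n' + n''), (forall j, R (w 0 j)) /\ v = w *m C.
  move=> Pv; have [w Rw ew] := (fr''.2 _).1 (hB _ Pv).
  have Pvh : P (v - w *m h).
    have /fr.2[v' Rv' ->] := Pv.
    have [U RU ->] := free_on_mx (B := h) fr (fun i => eq_ind _ P (hh0 i).1 _ (esym (rowK _ i))).
    apply/fr.2; exists (v' - w *m U); last by rewrite mulmxBl mulmxA.
    by move=> j; rewrite !mxE; apply: subringB => //; apply: subring_sum => // i _; apply: subringM.
  have /(hK _ Pvh)[u /fr'.2[u' Ru' ->] eu] : (v - w *m h) *m B = 0.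
    by rewrite mulmxBl -mulmxA hhB -ew subrr.
  exists (row_mx u' w); split; last by rewrite mul_row_col mulmxA -eu subrK.
  by move=> j; case: (split_ordP j) => l ->; rewrite ?row_mxEl ?row_mxEr.
have /choice[d hd] : forall i : 'I_n, exists w : 'rV_(n' + n''),
    (forall j, R (w 0 j)) /\ row i g = w *m C.
  by move=> i; apply: genC; apply: (free_on_row hR).
pose D' : 'M[L]_(n, n' + n'') := \matrix_i d i.
have gD' : g = D' *m C.
  by apply/row_matrixP => i; rewrite row_mul rowK; case: (hd i).
have RD' i j : R (D' i j) by rewrite mxE; case: (hd i).
have injC (w : 'rV_(n' + n'')) : (forall j, R (w 0 j)) -> w *m C = 0 -> w = 0.
  move=> Rw; rewrite -[w]hsubmxK mul_row_col => wC.
  have r0 : rsubmx w = 0.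
    have := congr1 (mulmx^~ B) wC.
    rewrite mulmxDl -!mulmxA AB !mulmx0 add0r hhB mul0mx => e.
    by rewrite -[rsubmx w](mulmxK gU'') e mul0mx.
  move: wC; rewrite r0 mul0mx addr0 mulmxA => /inj l0.
  suff -> : lsubmx w = 0 by rewrite row_mx0.
  rewrite -[lsubmx w](mulmxK gU') l0 ?mul0mx //; apply/fr'.2.
  by exists (lsubmx w) => // j; rewrite mxE.
exists h, D, D'; split=> //.
  apply/eqP; rewrite -subr_eq0; apply/eqP/row_matrixP => i; rewrite row0.
  apply: injC; last first.
    by rewrite -row_mul mulmxBl -mulmxA -gD' mul1mx [C]eD subrr row0.
  move=> j; rewrite !mxE; apply: subringB => //.
    by apply: subring_sum => // l _; apply: subringM.
  by case: (i == j); [apply: subring1 | apply: subring0].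
by apply: (can_inj (mulmxK gU)); rewrite -mulmxA -eD -gD' mul1mx.
Qed.

Lemma exact_rank : n = (n' + n'')%N.
Proof.
have [h [D [D' [_ _ _ DD' D'D]]]] := exact_basis.
by apply/eqP; rewrite eqn_leq (mulmx1_min DD') (mulmx1_min D'D).
Qed.

Lemma exact_section : exists h0 : 'M[L]_(n'', n), h0 *m B = 1%:M.
Proof.
have [h [D [D' [[hB _] _ _ _ _]]]] := exact_basis.
by exists (invmx g'' *m h); rewrite -mulmxA hB mulVmx //; case: fr''.
Qed.

End Exact.

(** Both [h] and [g'' *m h0] lift [g''] along [B], so they differ by a combination of the rows of
    [A]. Thus the basis [col_mx (g' *m A) h] is a block triangular matrix with diagonal [g'], [g'']
    times [col_mx A h0], and the unit [e] is the determinant of its change of basis to [g]. The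
    factor [\det (col_mx A h0)] is independent of the local bases. *)
Lemma exact_det R n' n'' (P' : 'rV[L]_n' -> Prop) (P : 'rV[L]_(n' + n'') -> Prop)
  (P'' : 'rV[L]_n'' -> Prop) g' g g'' A B h0 :
  subring R -> free_on R P' g' -> free_on R P g -> free_on R P'' g'' ->
  exact_on P' P P'' A B -> h0 *m B = 1%:M ->
  exists e e', [/\ R e, R e', e * e' = 1 &
    \det (col_mx A h0) * (\det g' * \det g'') = e * \det g].
Proof.
move=> hR fr' fr fr'' ex h0B.
have AB := exact_mul0 hR fr' ex.
have [h [D [D' [[hB eD] RD RD' DD' D'D]]]] := exact_basis hR fr' fr fr'' ex.
have [gU' _] := fr'; have [gU _] := fr; have [gU'' _] := fr''.
exists (\det D), (\det D'); split; try exact: subring_det.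
  by rewrite -det_mulmx DD' det1.
have CU : col_mx (g' *m A) h \in unitmx.
  by rewrite eD unitmx_mul gU andbT; case: (mulmx1_unit DD').
(* The coordinates of [h0] in the lifted basis; applying [B] shows that their right block is inverse
   to [g'']. *)
pose q := h0 *m invmx (col_mx (g' *m A) h).
have eq0 : h0 = lsubmx q *m (g' *m A) + rsubmx q *m h.
  by rewrite -mul_row_col hsubmxK mulmxKV.
have eq1 : g'' *m rsubmx q = 1%:M.
  have := congr1 (mulmx^~ B) eq0; rewrite h0B mulmxDl -!mulmxA AB !mulmx0 add0r hB => e.
  by rewrite (mulmx1C (esym e)).
rewrite -det_mulmx -eD mulrC -(det_lblock _ (- (g'' *m (lsubmx q *m g')))).
have <- : block_mx g' 0 (- (g'' *m (lsubmx q *m g'))) g'' *m col_mx A h0 =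
          col_mx (g' *m A) h.
  rewrite -[X in X *m _]/(col_mx (row_mx _ _) (row_mx _ _)) mul_col_mx !mul_row_col.
  rewrite mul0mx addr0; congr col_mx.
  by rewrite {1}eq0 mulmxDr mulNmx !mulmxA eq1 mul1mx addKr.
by rewrite det_mulmx.
Qed.

Lemma covers_nonempty R (s : seq L) : covers R s -> exists x, x \in s.
Proof.
case: s => [[_ [c _]]|x s _]; last by exists x; rewrite mem_head.
by rewrite big_nil => /esym/eqP; rewrite oner_eq0.
Qed.

Lemma common_refinement R n' n n'' (P' : 'rV[L]_n' -> Prop) (P : 'rV[L]_n -> Prop)
  (P'' : 'rV[L]_n'' -> Prop) : subring R ->
  locally_free R P' -> locally_free R P -> locally_free R P'' ->
  exists s' s s'', [/\ covers R s', covers R s, covers R s'' &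
    forall x y z, x \in s' -> y \in s -> z \in s'' ->
    [/\ R (x * y * z), x * y * z != 0 & exists g' g g'',
     [/\ free_on (loc (x * y * z) R) (localize (x * y * z) P') g',
         free_on (loc (x * y * z) R) (localize (x * y * z) P) g &
         free_on (loc (x * y * z) R) (localize (x * y * z) P'') g'']]].
Proof.
move=> hR /locally_freeP[hP' [s' hs' fr']] /locally_freeP[hP [s hs fr]].
move=> /locally_freeP[hP'' [s'' hs'' fr'']].
exists s', s, s''; split=> // x y z xs ys zs.
have [Rx x0] := hs'.1 x xs; have [Ry y0] := hs.1 y ys; have [Rz z0] := hs''.1 z zs.
have [g' f'] := fr' x xs; have [g f] := fr y ys; have [g'' f''] := fr'' z zs.
have Rxy := subringM hR Rx Ry; have xy0 : x * y != 0 by rewrite mulf_neq0.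
split; [exact: subringM | by rewrite mulf_neq0 | exists g', g, g''; split].
- exact: free_onM hR hP' Rxy Rz xy0 z0 (free_onM hR hP' Rx Ry x0 y0 f').
- by apply: free_onM => //; rewrite [x * y]mulrC; apply: free_onM.
- by rewrite mulrC; apply: free_onM.
Qed.

(** Both conclusions are statements over the field [L], so it is enough to look at a single piece of
    the common refinement. *)
Lemma exact_rank_section R n' n n'' (P' : 'rV[L]_n' -> Prop) (P : 'rV[L]_n -> Prop)
  (P'' : 'rV[L]_n'' -> Prop) A B : subring R ->
  locally_free R P' -> locally_free R P -> locally_free R P'' ->
  exact_on P' P P'' A B -> n = (n' + n'')%N /\ exists h0 : 'M[L]_(n'', n), h0 *m B = 1%:M.
Proof.
move=> hR lf' lf lf'' ex.
have [s' [s [s'' [hs' hs hs'' ref]]]] := common_refinement hR lf' lf lf''.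
have [x xs] := covers_nonempty hs'; have [y ys] := covers_nonempty hs.
have [z zs] := covers_nonempty hs''.
have [Rw w0 [g' [g [g'' [f' f f'']]]]] := ref x y z xs ys zs.
have hRw := localize_subring hR Rw w0.
by split; [apply: (exact_rank hRw f' f f'') | apply: (exact_section hRw f' f f'')];
  apply: localize_exact ex.
Qed.

(** On each piece of the common refinement the generators of the two sides differ by a unit. The
    factor depends on [A] and [h0] alone, so the same one works for every ring [R], that is for
    every chart. *)
Lemma det_exact R n' n'' (P' : 'rV[L]_n' -> Prop) (P : 'rV[L]_(n' + n'') -> Prop)
  (P'' : 'rV[L]_n'' -> Prop) A B h0 : subring R ->
  locally_free R P' -> locally_free R P -> locally_free R P'' ->
  exact_on P' P P'' A B -> h0 *m B = 1%:M ->
  \det (col_mx A h0) != 0 /\ forall v, det_ideal R P v <->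
    ideal_mul R (det_ideal R P') (det_ideal R P'') (v / \det (col_mx A h0)).
Proof.
move=> hR lf' lf lf'' ex h0B.
have [s' [s [s'' [hs' hs hs'' ref]]]] := common_refinement hR lf' lf lf''.
have [hP' _] := lf'; have [hP _] := lf; have [hP'' _] := lf''.
pose J := ideal_mul R (det_ideal R P') (det_ideal R P'').
set f := \det (col_mx A h0).
have main x y z : x \in s' -> y \in s -> z \in s'' ->
    [/\ f != 0, R (x * y * z), x * y * z != 0 & exists d d',
     [/\ principal_at R (x * y * z) (det_ideal R P) d,
      principal_at R (x * y * z) (fun v => J (v / f)) d',
      loc (x * y * z) R (d / d') & loc (x * y * z) R (d' / d)]].
  move=> xs ys zs; have [Rw w0 [g1 [g2 [g3 [f1 f2 f3]]]]] := ref x y z xs ys zs.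
  have hRw := localize_subring hR Rw w0.
  have [e [e' [Re Re' ee' edet]]] := exact_det hRw f1 f2 f3 (localize_exact w0 ex) h0B.
  have p1 := det_principal_at hR hP' Rw w0 f1.
  have p2 := det_principal_at hR hP Rw w0 f2.
  have p3 := det_principal_at hR hP'' Rw w0 f3.
  have e0 : e != 0 by apply: contra_eq_neq ee' => ->; rewrite mul0r eq_sym oner_neq0.
  have d0 : \det g2 != 0 by case: p2.
  have f0 : f != 0.
    by apply: contra_eq_neq edet => f0; rewrite /f in f0; rewrite f0 mul0r eq_sym mulf_neq0.
  split=> //; exists (\det g2), (f * (\det g1 * \det g3)); split=> //.
  - by apply: principal_at_scale => //; apply: principal_at_mul.
  - rewrite edet invfM mulrCA divff // mulr1.
    by rewrite -[e^-1]mulr1 -ee' mulKf.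
  - by rewrite edet mulfK.
have hJ : submodule (V := L^o) R (fun v => J (v / f)).
  have hJ0 : submodule (V := L^o) R J by apply: lspan_submod.
  split=> [|a u v Ra hu hv]; first by rewrite mul0r; case: hJ0.
  by rewrite mulrDl scale_reg -mulrA; apply: hJ0.2.
split.
  have [x xs] := covers_nonempty hs'; have [y ys] := covers_nonempty hs.
  by have [z zs] := covers_nonempty hs''; have [] := main x y z xs ys zs.
move=> v; split=> hv.
  apply: (cover_local3 (V := L^o) hR hJ hs' hs hs'') => x y z xs ys zs.
  have [_ Rw w0 [d [d' [p1 p2 dd' _]]]] := main x y z xs ys zs.
  apply: (principal_at_eq hR Rw w0 p1 p2 dd'); exact: localize_self.
apply: (cover_local3 (V := L^o) hR (lspan_submod hR _) hs' hs hs'') => x y z xs ys zs.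
have [_ Rw w0 [d [d' [p1 p2 _ d'd]]]] := main x y z xs ys zs.
apply: (principal_at_eq hR Rw w0 p2 p1 d'd); exact: localize_self.
Qed.

End Bundles.

(** * Laurent monomials *)

Section MonomialFactors.
Variables (k : fieldType) (n : nat).
Implicit Types (p q : {mpoly k[n]}) (m : 'X_{1..n}).

Lemma mpolyX_neq0 m : ('X_[m] : {mpoly k[n]}) != 0.
Proof.
by apply/eqP => /(congr1 (mcoeff m)) /eqP; rewrite mcoeffX eqxx mcoeff0 oner_eq0.
Qed.

Definition kill_var (i : 'I_n) p : {mpoly k[n]} :=
  p \mPo [tuple if j == i then 0 else 'X_j | j < n].

Lemma mcoeff_kill_var i p m : m i = 0%N -> (kill_var i p)@_m = p@_m.
Proof.
move=> mi; rewrite /kill_var comp_mpolyEX [in RHS](mpolyE p) !raddf_sum /=.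
apply: eq_bigr => m' _; rewrite !mcoeffZ comp_mpolyX; congr (_ * _).
have [m'i|m'i] := eqVneq (m' i) 0%N.
  rewrite mpolyXE_id; congr (_ @_ _); apply: eq_bigr => j _.
  by rewrite tnth_mktuple; case: eqP => // ->; rewrite m'i !expr0.
rewrite (bigD1 i) //= tnth_mktuple eqxx expr0n (negPf m'i) mul0r mcoeff0 mcoeffX.
by case: eqP => // e; rewrite e mi eqxx in m'i.
Qed.

Lemma kill_var_dvd i p : kill_var i p = 0 -> exists p', p = p' * 'X_i.
Proof.
move=> p0; exists (\sum_(m <- msupp p) p@_m *: 'X_[m - U_(i)]).
rewrite {1}(mpolyE p) mulr_suml; apply: eq_big_seq => m mp.
rewrite -scalerAl -mpolyXD submK // lep1mP.
apply: contraTneq mp => mi; rewrite mcoeff_msupp negbK.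
by rewrite -(mcoeff_kill_var p mi) p0 mcoeff0.
Qed.

(** Induction on the degree: if a variable divides the product, setting it to zero kills one of the
    factors, and this factor is then divisible by the variable. In degree zero [p] is a unit, hence
    a constant. *)
Lemma monomial_factor p q m : p * q = 'X_[m] ->
  exists c m', c != 0 /\ p = c *: 'X_[m'].
Proof.
have [d] := ubnP (mdeg m); elim: d => // d IHd in p q m *.
rewrite ltnS => led pq.
have [m0|[i mi]] : m = 0%MM \/ exists i, (m i != 0)%N.
  have [/existsP[i mi]|/existsPn h] := boolP [exists i, m i != 0%N]; first by right; exists i.
  by left; apply/mnmP => i; rewrite mnm0E; apply/eqP; have := h i; rewrite negbK.
  have : p \is a GRing.unit.
    by apply/unitrPr; exists q; rewrite pq m0 mpolyX0.
  rewrite unfold_in /= /mpoly_unit => /andP[/eqP ep].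
  by rewrite unitfE => c0; exists p@_0, 0%MM; rewrite mpolyX0 -mul_mpolyC mulr1 -ep.
have Xi0 : ('X_i : {mpoly k[n]}) != 0 by exact: mpolyX_neq0.
have em : 'X_[m] = 'X_[m - U_(i)] * 'X_i :> {mpoly k[n]} by rewrite -mpolyXD submK // lep1mP.
have ltm : (mdeg (m - U_(i))%MM < d)%N.
  by rewrite -(@submK _ U_(i)%MM m) ?lep1mP // mdegD mdeg1 addn1 in led.
have /eqP : kill_var i p * kill_var i q = 0.
  rewrite -[_ * _](rmorphM (comp_mpoly _)) /= pq comp_mpolyX (bigD1 i) //=.
  by rewrite tnth_mktuple eqxx expr0n (negPf mi) mul0r.
rewrite mulf_eq0 => /orP[] /eqP/kill_var_dvd[r er].
  have [|c [m' [c0 e]]] := IHd r q _ ltm.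
    by apply: (mulIf Xi0); rewrite -em -pq er mulrAC.
  by exists c, (m' + U_(i))%MM; split=> //; rewrite er e mpolyXD scalerAl.
by apply: (IHd p r _ ltm); apply: (mulIf Xi0); rewrite -em -pq er mulrA.
Qed.

End MonomialFactors.

(** * Laurent monomials, coordinate rings of charts and units of the torus *)

Section Laurent.
Variables (k : fieldType) (E : finType).
Local Notation L := (ratfun k E).
Local Notation tofrac := (@FracField.tofrac {mpoly k[#|E|]}).
Implicit Types (m : {ffun E -> int}) (F : {set E}) (S : {set {set E}}).

Lemma scalarM (c d : k) : scalar E (c * d) = scalar E c * scalar E d.
Proof. by rewrite /scalar mpolyCM rmorphM. Qed.
Lemma scalarN (c : k) : scalar E (- c) = - scalar E c.
Proof. by rewrite /scalar mpolyCN rmorphN. Qed.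
Lemma scalar1 : scalar E (1 : k) = 1.
Proof. by rewrite /scalar mpolyC1 rmorph1. Qed.
Lemma scalar_eq0 (c : k) : (scalar E c == 0) = (c == 0).
Proof. by rewrite /scalar tofrac_eq0 mpolyC_eq0. Qed.

Lemma tofracX_neq0 (i : E) : tofrac 'X_(enum_rank i) != 0.
Proof. by rewrite tofrac_eq0 mpolyX_neq0. Qed.

Lemma chi0 : chi k (0 : {ffun E -> int}) = 1.
Proof. by rewrite /chi big1 // => i _; rewrite ffunE expr0z. Qed.

Lemma chiD m m' : chi k (m + m') = chi k m * chi k m'.
Proof.
by rewrite /chi -big_split; apply: eq_bigr => i _; rewrite ffunE expfzDr // tofracX_neq0.
Qed.

Lemma chi_neq0 m : chi k m != 0.
Proof. by apply/prodf_neq0 => i _; rewrite expfz_neq0 // tofracX_neq0. Qed.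

Lemma chiN m : chi k (- m) = (chi k m)^-1.
Proof. by apply: (mulIf (chi_neq0 m)); rewrite -chiD addNr chi0 mulVf // chi_neq0. Qed.

Lemma pairingD m m' F : pairing (m + m') F = pairing m F + pairing m' F.
Proof. by rewrite /pairing -big_split; apply: eq_bigr => i _; rewrite ffunE. Qed.
Lemma pairingN m F : pairing (- m) F = - pairing m F.
Proof. by rewrite /pairing -sumrN; apply: eq_bigr => i _; rewrite ffunE. Qed.
Lemma pairing0 F : pairing (0 : {ffun E -> int}) F = 0.
Proof. by rewrite /pairing big1 // => i _; rewrite ffunE. Qed.

Lemma characterE m : character m <-> pairing m setT = 0.
Proof.
have -> // : pairing m setT = \sum_i m i.
by apply: eq_bigl => i; rewrite inE.
Qed.
Lemma characterD m m' : character m -> character m' -> character (m + m').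
Proof. by rewrite !characterE pairingD => -> ->; rewrite addr0. Qed.
Lemma characterN m : character m -> character (- m).
Proof. by rewrite !characterE pairingN => ->; rewrite oppr0. Qed.
Lemma character0 : character (0 : {ffun E -> int}).
Proof. by rewrite characterE pairing0. Qed.

Lemma pairing_unit (i : E) F : pairing [ffun s => (s == i)%:R] F = (i \in F)%:R.
Proof.
rewrite /pairing; under eq_bigr do rewrite ffunE.
have [iF|iF] := boolP (i \in F).
  by rewrite (bigD1 i) //= eqxx big1 ?addr0 // => s /andP[_ /negPf->].
by rewrite big1 // => s sF; case: eqP => // e; rewrite -e sF in iF.
Qed.

Definition exponent m : 'X_{1..#|E|} := [multinom `|m (enum_val j)|%N | j < #|E|].

Lemma chi_nonneg m : (forall i, 0 <= m i) -> chi k m = tofrac 'X_[exponent m].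
Proof.
move=> m0; rewrite mpolyXE_id rmorph_prod /= (reindex_onto enum_rank enum_val) /=; last first.
  by move=> j _; rewrite enum_valK.
rewrite /chi; apply: eq_big => [i|i _]; first by rewrite enum_rankK eqxx.
by rewrite rmorphXn /= mnmE enum_rankK -{1}[m i]gez0_abs.
Qed.

Lemma exponent_inj m m' : (forall i, 0 <= m i) -> (forall i, 0 <= m' i) ->
  exponent m = exponent m' -> m = m'.
Proof.
move=> m0 m'0 e; apply/ffunP => i; have := congr1 (fun x : 'X_{1..#|E|} => x (enum_rank i)) e.
by rewrite /= !mnmE enum_rankK => h; rewrite -(gez0_abs (m0 i)) h gez0_abs.
Qed.

(** Multiplying by the monomial with this exponent, in general not a character, clears the
    denominators of a Laurent polynomial. *)
Definition const_exp (N : nat) : {ffun E -> int} := [ffun=> N%:Z].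

Lemma exists_shift (s : seq {ffun E -> int}) :
  exists N, forall m, m \in s -> forall i, 0 <= (m + const_exp N) i.
Proof.
exists (\sum_(m <- s) \sum_i `|m i|%N)%N => m ms i; rewrite !ffunE.
rewrite (big_rem m) //= (bigD1 i) //=; lia.
Qed.

Definition laurent (s : seq (k * {ffun E -> int})) : L :=
  \sum_(cm <- s) scalar E cm.1 * chi k cm.2.

Lemma laurent_poly s N :
  (forall m, m \in map snd s -> forall i, 0 <= (m + const_exp N) i) ->
  laurent s * chi k (const_exp N) =
    tofrac (\sum_(cm <- s) cm.1 *: 'X_[exponent (cm.2 + const_exp N)]).
Proof.
move=> hN; rewrite /laurent mulr_suml rmorph_sum /=; apply: eq_big_seq => cm cms.
rewrite -mulrA -chiD chi_nonneg; last by apply: hN; apply: map_f.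
by rewrite -mul_mpolyC rmorphM.
Qed.

(** Linear independence of Laurent monomials, by comparing coefficients after clearing denominators.
    It makes conditions on exponents readable from membership in [char_span]. *)
Lemma laurent_monomial s c m : c != 0 -> laurent s = scalar E c * chi k m ->
  exists2 cm, cm \in s & cm.2 = m.
Proof.
move=> c0 es; have [N hN] := exists_shift (m :: map snd s).
have hm : forall i, 0 <= (m + const_exp N) i by apply: hN; rewrite mem_head.
have hs m' : m' \in map snd s -> forall i, 0 <= (m' + const_exp N) i.
  by move=> ms; apply: hN; rewrite inE ms orbT.
have /eqP := laurent_poly hs.
rewrite es -mulrA -chiD chi_nonneg // -[scalar E c]/(tofrac _) -rmorphM tofrac_eq mul_mpolyC.
move=> /eqP/(congr1 (mcoeff (exponent (m + const_exp N)))).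
rewrite mcoeffZ mcoeffX eqxx mulr1 raddf_sum /= => ec.
have [/hasP[cm cms /eqP e]|/hasPn hn] := boolP (has (fun cm => cm.2 == m) s); first by exists cm.
move: c0; rewrite ec big_seq big1 ?eqxx // => cm cms.
rewrite mcoeffZ mcoeffX; case: eqP => [e|_]; last by rewrite mulr0.
have := hn cm cms; rewrite -(inj_eq (addIr (const_exp N))) => /eqP[].
apply: exponent_inj => //; apply: hs; exact: map_f.
Qed.

Section CharSpan.
Variable Q : {ffun E -> int} -> Prop.

Lemma char_span0 : char_span Q (0 : L).
Proof. by exists [::]; rewrite ?big_nil. Qed.

Lemma char_spanD (f g : L) : char_span Q f -> char_span Q g -> char_span Q (f + g).
Proof.
move=> [s hs ->] [t ht ->]; exists (s ++ t); last by rewrite big_cat.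
by move=> cm; rewrite mem_cat => /orP[/hs|/ht].
Qed.

Lemma char_span_monomial c m : character m -> Q m -> char_span Q (scalar E c * chi k m).
Proof.
move=> hm Qm; exists [:: (c, m)]; last by rewrite big_seq1.
by move=> cm; rewrite inE => /eqP->.
Qed.

Lemma char_span_chi m : character m -> Q m -> char_span Q (chi k m).
Proof. by rewrite -[chi k m]mul1r -scalar1; apply: char_span_monomial. Qed.

Lemma char_span_ind (P : L -> Prop) : P 0 -> (forall f g, P f -> P g -> P (f + g)) ->
  (forall c m, character m -> Q m -> P (scalar E c * chi k m)) ->
  forall f, char_span Q f -> P f.
Proof.
move=> P0 PD Pm _ [s hs ->]; rewrite big_seq; apply: (big_ind P) => // cm /hs[hc hq].
exact: Pm.
Qed.

End CharSpan.

Lemma char_spanM (Q Q' Q'' : {ffun E -> int} -> Prop) (f g : L) :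
  (forall m m', Q m -> Q' m' -> Q'' (m + m')) ->
  char_span Q f -> char_span Q' g -> char_span Q'' (f * g).
Proof.
move=> QQ hf hg; move: f hf; apply: char_span_ind => [|f f' hf hf'|c m hm Qm].
- by rewrite mul0r; apply: char_span0.
- by rewrite mulrDl; apply: char_spanD.
move: g hg; apply: char_span_ind => [|g g' hg hg'|d m' hm' Qm'].
- by rewrite mulr0; apply: char_span0.
- by rewrite mulrDr; apply: char_spanD.
rewrite mulrACA -scalarM -chiD; apply: char_span_monomial; first exact: characterD.
exact: QQ.
Qed.

Lemma char_span_sub (Q Q' : {ffun E -> int} -> Prop) (f : L) :
  (forall m, Q m -> Q' m) -> char_span Q f -> char_span Q' f.
Proof. by move=> QQ [s hs ->]; exists s => // cm /hs[hc /QQ]. Qed.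

Lemma chart_subring S : subring (@chart_ring k E S).
Proof.
split.
- by rewrite -chi0; apply: char_span_chi; [exact: character0 | move=> F _; rewrite pairing0].
- move=> a b Ra Rb; apply: char_spanD => //; rewrite -mulN1r.
  apply: (char_spanM (Q := fun m => forall F, F \in S -> 0 <= pairing m F) _ _ Rb).
    by move=> m m' h h' F FS; rewrite pairingD addr_ge0 ?h ?h'.
  rewrite -scalar1 -scalarN -[scalar _ _]mulr1 -chi0.
  apply: char_span_monomial; first exact: character0.
  by move=> F _; rewrite pairing0.
- move=> a b; apply: char_spanM => m m' h h' F FS.
  by rewrite pairingD addr_ge0 ?h ?h'.
Qed.

Lemma chart_sub S S' (f : L) : S \subset S' -> chart_ring S' f -> chart_ring S f.
Proof. by move=> /subsetP sub; apply: char_span_sub => m h F FS; apply/h/sub. Qed.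

Lemma chart_monomial S c m : c != 0 -> chart_ring S (scalar E c * chi k m) ->
  character m /\ forall F, F \in S -> 0 <= pairing m F.
Proof.
move=> c0 [s hs es]; have [cm cms <-] := laurent_monomial c0 (esym es).
exact: hs.
Qed.

(** The chart of the empty set is the torus. Up to a monomial, [f] and its inverse are polynomials
    whose product is a monomial, so [monomial_factor] applies. *)
Lemma torus_unit (f : L) : f != 0 -> chart_ring set0 f -> chart_ring set0 f^-1 ->
  exists c m, [/\ c != 0, character m & f = scalar E c * chi k m].
Proof.
move=> f0 [s hs ef] [t _ eg].
have [N hN] := exists_shift (map snd s ++ map snd t).
have hNs m : m \in map snd s -> forall i, 0 <= (m + const_exp N) i.
  by move=> ms; apply: hN; rewrite mem_cat ms.
have hNt m : m \in map snd t -> forall i, 0 <= (m + const_exp N) i.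
  by move=> ms; apply: hN; rewrite mem_cat ms orbT.
have ep := laurent_poly hNs; have eq := laurent_poly hNt.
rewrite -[laurent s]ef in ep; rewrite -[laurent t]eg in eq.
move: ep eq; set p := (\sum_(cm <- s) _); set q := (\sum_(cm <- t) _) => ep eq.
have cN0 : forall i, 0 <= (const_exp N + const_exp N) i by move=> i; rewrite !ffunE; lia.
have [c [m' [c0 ep']]] : exists c (m' : 'X_{1..#|E|}), c != 0 /\ p = c *: 'X_[m'].
  apply: (@monomial_factor _ _ p q (exponent (const_exp N + const_exp N))).
  apply/eqP; rewrite -tofrac_eq rmorphM /= -ep -eq -chi_nonneg // chiD.
  by rewrite mulrACA divff // mul1r.
pose m : {ffun E -> int} := [ffun i => (m' (enum_rank i))%:Z].
have em' : exponent m = m' by apply/mnmP => j; rewrite mnmE ffunE enum_valK.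
have efm : f = scalar E c * chi k (m - const_exp N).
  rewrite chiD chiN mulrA; apply: (canRL (mulfK (chi_neq0 _))).
  rewrite ep ep' -mul_mpolyC rmorphM /=; congr (_ * _).
  by rewrite chi_nonneg ?em' // => i; rewrite ffunE.
exists c, (m - const_exp N); split=> //.
(* The exponent has sum zero because it must occur among the exponents of the given expansion of
   [f]. *)
have [cm cms <-] := laurent_monomial c0 (etrans (esym ef) efm).
by case: (hs cm cms).
Qed.

(** Sections of O(D) have pairings at least [- a F]; a character attaining all these bounds
    generates them. *)
Lemma line_div_local (a : {set E} -> int) S m : character m ->
  (forall F, F \in S -> pairing m F = - a F) ->
  forall v : L, line_div a S v <-> chart_ring S (v / chi k m).
Proof.
move=> hm hma v; rewrite -chiN; split=> hv.
  apply: (char_spanM _ hv (char_span_chi (Q := fun m' => m' = - m) (characterN hm) _)) => //.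
  by move=> m1 _ h -> F FS; rewrite pairingD pairingN hma // opprK -(opprK (a F)) subr_ge0 h.
have -> : v = v * chi k (- m) * chi k m by rewrite -mulrA -chiD addNr chi0 mulr1.
apply: (char_spanM _ hv (char_span_chi (Q := fun m' => m' = m) hm _)) => //.
by move=> m1 _ h -> F FS; rewrite pairingD hma // lerDr h.
Qed.

End Laurent.

(** * Flats, building sets and nested sets *)

Section Flats.
Variables (E : finType) (M : matroid E).
Implicit Types (A B F H K : {set E}).
Local Open Scope nat_scope.

Lemma rk_set0 : M set0 = 0.
Proof. by apply/eqP; rewrite -leqn0 -(cards0 E) rk_le_card. Qed.

Lemma sub_closure A : A \subset closure M A.
Proof. by apply/subsetP => i iA; rewrite inE (setUidPr _) ?sub1set. Qed.

Lemma closure_mono A B : A \subset B -> closure M A \subset closure M B.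
Proof.
move=> AB; apply/subsetP => i; rewrite !inE => /eqP iA.
rewrite eqn_leq [X in _ && X]rk_mono ?subsetUr // andbT.
have := rk_submod M (i |: A) B; rewrite iA -setUA (setUidPr AB) => h.
have : M A <= M ((i |: A) :&: B) by apply: rk_mono; rewrite subsetI subsetUr.
lia.
Qed.

Lemma rk_closure A : M (closure M A) = M A.
Proof.
have step (s : seq E) : {subset s <= closure M A} -> M (A :|: [set i in s]) = M A.
  elim: s => [|i s IHs] h; first by rewrite set_nil setU0.
  have {}IHs : M (A :|: [set i in s]) = M A by apply: IHs => j js; apply: h; rewrite inE js orbT.
  have := closure_mono (subsetUl A [set i in s]) => /subsetP/(_ i (h i (mem_head _ _))).
  by rewrite inE IHs set_cons setUCA => /eqP.
rewrite -(step (enum (closure M A))); last by move=> i; rewrite mem_enum.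
by rewrite set_enum (setUidPr (sub_closure A)).
Qed.

Lemma flat_closure A : flat M (closure M A).
Proof.
rewrite /flat eqEsubset sub_closure andbT; apply/subsetP => i; rewrite !inE.
rewrite rk_closure => /eqP h; rewrite eqn_leq -{1}h !rk_mono ?subsetUr //.
by rewrite setUS // sub_closure.
Qed.

Lemma closure_flat F : flat M F -> closure M F = F. Proof. by move/eqP. Qed.

Lemma closure_min A F : flat M F -> A \subset F -> closure M A \subset F.
Proof. by move=> /closure_flat e AF; have := closure_mono AF; rewrite e. Qed.

Lemma flatI F H : flat M F -> flat M H -> flat M (F :&: H).
Proof.
move=> hF hH; rewrite /flat eqEsubset sub_closure andbT subsetI.
by rewrite !closure_min // ?subsetIl ?subsetIr.
Qed.

Lemma flat_rk_proper F K : flat M F -> F \proper K -> M F < M K.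
Proof.
move=> /closure_flat eF /properP[FK [i iK]]; rewrite -{1}eF inE => iF.
apply: (@leq_trans (M (i |: F))); last by rewrite rk_mono // subUset sub1set iK.
by rewrite ltn_neqAle eq_sym iF rk_mono ?subsetUr.
Qed.

(** The closure of a largest subset [A] of [F] of smaller rank will do: one more point of [F] brings
    [A] to full rank and raises the rank by at most one. *)
Lemma flat_predecessor F : flat M F -> 0 < M F ->
  exists2 K, flat M K & K \proper F /\ M F <= (M K).+1.
Proof.
move=> hF F0.
have P0 : (set0 \subset F) && (M set0 < M F) by rewrite sub0set rk_set0.
case: (@arg_maxnP _ set0 (fun A => (A \subset F) && (M A < M F)) (fun A => #|A|) P0).
move=> A /andP[AF ltA] maxA; exists (closure M A); first exact: flat_closure.
have leAF : closure M A \subset F by apply: closure_min.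
split.
  rewrite properEneq leAF andbT; apply: contraTneq ltA => e.
  by rewrite -rk_closure e ltnn.
have /subsetPn[i iF iA] : ~~ (F \subset A).
  by apply: contraTN ltA => FA; rewrite -leqNgt rk_mono.
rewrite rk_closure leqNgt; apply/negP => lt2.
have := maxA (i |: A); rewrite subUset sub1set iF AF /= cardsU1 iA => h.
suff : M (i |: A) < M F by move/h; rewrite add1n ltnn.
apply: leq_ltn_trans lt2.
have := rk_submod M [set i] A; have := rk_le_card M [set i]; rewrite cards1.
lia.
Qed.

Lemma rk_cover (P : {set {set E}}) : M (cover P) <= \sum_(H in P) M H.
Proof.
rewrite /cover; elim/big_rec2: _ => [|H n A _ le]; first by rewrite rk_set0.
have := rk_submod M H A; lia.
Qed.

Hypothesis hM : loopless M.

Lemma flat_set0 : flat M set0.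
Proof.
rewrite /flat eqEsubset sub0set andbT; apply/subsetP => i.
by rewrite !inE setU0 rk_set0 hM.
Qed.

Lemma closure1_sym (i j : E) F : flat M F -> j \in closure M [set i] -> j \in F -> i \in F.
Proof.
move=> hF; rewrite inE hM setUC => /eqP h jF.
have /subsetP : closure M [set j] \subset F by apply: closure_min; rewrite ?sub1set.
by apply; rewrite inE hM h.
Qed.

End Flats.

(** * Factors in a building set and cones of nested sets *)

Section Building.
Variables (E : finType) (M : matroid E) (G : {set {set E}}).
Hypotheses (hM : loopless M) (hG : building_set M G).
Implicit Types (F H K : {set E}) (S T : {set {set E}}).

Lemma building_flat F : F \in G -> flat M F. Proof. by case/(hG.1 F). Qed.
Lemma building_neq0 F : F \in G -> F != set0. Proof. by case/(hG.1 F). Qed.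

Lemma mem_Fac F H : H \in Fac G F ->
  [/\ H \in G, H \subset F & forall K, K \in G -> K \subset F -> H \subset K -> K = H].
Proof.
rewrite inE => /maxsetP[/= /andP[HG HF] mx]; split=> // K KG KF HK.
by apply: mx => //; rewrite /= KG.
Qed.

Lemma sub_Fac F H : H \in G -> H \subset F -> exists2 K, K \in Fac G F & H \subset K.
Proof.
move=> HG HF.
have /maxset_exists[K mK HK] : [pred H' : {set E} | (H' \in G) && (H' \subset F)] H.
  by rewrite /= HG.
by exists K => //; rewrite inE.
Qed.

Definition fac_single H K : {ffun {set E} -> {set E}} :=
  [ffun X => if X == H then K else set0].

Lemma fac_single_prod F H K : H \in Fac G F -> flat M K -> K \subset H ->
  fac_prod M G F (fac_single H K).
Proof.
move=> HF hK KH; apply/forallP => X; rewrite ffunE.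
have [->|_] := eqVneq X H; first by rewrite HF hK.
by case: ifP => // _; rewrite flat_set0 // sub0set.
Qed.

Lemma fac_joinE F phi : fac_join M G F phi = closure M (\bigcup_(H in Fac G F) phi H).
Proof. by rewrite /fac_join /joinF cover_imset. Qed.

Lemma fac_single_join F H K : H \in Fac G F -> flat M K ->
  fac_join M G F (fac_single H K) = K.
Proof.
move=> HF hK; rewrite fac_joinE (bigD1 H) //= ffunE eqxx big1 ?setU0 ?closure_flat //.
by move=> X /andP[_ XH]; rewrite ffunE (negPf XH).
Qed.

Section Factors.
Variables (F : {set E}) (hF : flat M F) (F0 : F != set0).

(** Placed in coordinate [H] or in coordinate [K], the intersection has the same join; as the join
    map is an order embedding, it must be empty. *)
Lemma Fac_disjoint H K : H \in Fac G F -> K \in Fac G F -> H != K -> H :&: K = set0.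
Proof.
move=> HF KF HK; have [HG _ _] := mem_Fac HF; have [KG _ _] := mem_Fac KF.
have fl : flat M (H :&: K) by apply: flatI; apply: building_flat.
have [mono _] := hG.2 F hF F0.
have := mono _ _ (fac_single_prod HF fl (subsetIl _ _)) (fac_single_prod KF fl (subsetIr _ _)).
rewrite !fac_single_join // subxx => /esym/forallP/(_ H).
by rewrite !ffunE eqxx (negPf HK) subset0 => /eqP.
Qed.

(** The flat [F] is the union of its factors, not just their join. The closure of a point [i] of [F]
    is a join of elements below the factors; one of these contains some [j], which is parallel to
    [i], and being a flat it contains [i] too. *)
Lemma cover_Fac : cover (Fac G F) = F.
Proof.
apply/eqP; rewrite eqEsubset; apply/andP; split.
  by apply/bigcupsP => H /mem_Fac[].
apply/subsetP => i iF.
have [_ surj] := hG.2 F hF F0.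
have iF1 : [set i] \subset F by rewrite sub1set.
have [phi hphi ephi] := surj _ (flat_closure M [set i]) (closure_min hF iF1).
have ii : i \in closure M [set i] by apply/(subsetP (sub_closure _ _)); rewrite inE.
have [H HF [j jH]] : exists2 H, H \in Fac G F & exists j, j \in phi H.
  have [h|] := boolP [exists H in Fac G F, phi H != set0].
    by have /existsP[H /andP[HF /set0Pn[j jH]]] := h; exists H => //; exists j.
  move/existsPn => h; move: ii; rewrite -ephi fac_joinE big1 ?closure_flat ?flat_set0 ?inE //.
  by move=> H HF; apply/eqP; have := h H; rewrite HF negbK.
have := forallP hphi H; rewrite HF => /andP[flH sH].
apply/bigcupP; exists H => //; apply: (subsetP sH).
apply: (closure1_sym hM flH _ jH); rewrite -ephi fac_joinE.
by apply/(subsetP (sub_closure _ _))/bigcupP; exists H.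
Qed.

Lemma trivIset_Fac : trivIset (Fac G F).
Proof.
apply/trivIsetP => H K HF KF HK; rewrite -setI_eq0.
by rewrite (Fac_disjoint HF KF HK).
Qed.

(** Lowering one coordinate to a flat of rank at most one less strictly lowers the join, since the
    join map reflects the order. Here [n] only bounds the induction. *)
Lemma fac_prod_rk n phi : fac_prod M G F phi -> (\sum_(H in Fac G F) M (phi H) <= n)%N ->
  (\sum_(H in Fac G F) M (phi H) <= M (fac_join M G F phi))%N.
Proof.
elim: n phi => [|n IHn] phi hphi; first by rewrite leqn0 => /eqP->.
move=> len; have [/eqP-> //|] := boolP (\sum_(H in Fac G F) M (phi H) == 0)%N.
rewrite sum_nat_eq0 => /forallPn[H]; rewrite negb_imply -lt0n => /andP[HF rH].
have := forallP hphi H; rewrite HF => /andP[flH sH].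
have [K flK [Kp leK]] := flat_predecessor flH rH.
pose psi : {ffun {set E} -> {set E}} := [ffun X => if X == H then K else phi X].
have hpsi : fac_prod M G F psi.
  apply/forallP => X; rewrite ffunE; have [->|_] := eqVneq X H.
    by rewrite HF flK (subset_trans (proper_sub Kp)).
  exact: (forallP hphi X).
have sub X : psi X \subset phi X.
  by rewrite ffunE; case: eqP => // ->; apply: proper_sub.
have [mono _] := hG.2 F hF F0.
have lt : (M (fac_join M G F psi) < M (fac_join M G F phi))%N.
  apply: flat_rk_proper; first exact: flat_closure.
  rewrite properE !mono //; apply/andP; split; first exact/forallP.
  apply/forallPn; exists H; rewrite ffunE eqxx; exact: (proper_subn Kp).
have es : (\sum_(H in Fac G F) M (phi H) <= (\sum_(H in Fac G F) M (psi H)).+1)%N.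
  rewrite !(bigD1 H HF) /= [psi H]ffunE eqxx -addSn; apply: leq_add => //.
  by apply: leq_sum => X /andP[_ XH]; rewrite ffunE (negPf XH).
apply: leq_trans es (leq_trans _ lt); rewrite ltnS; apply: IHn => //.
have : (\sum_(H in Fac G F) M (psi H) < \sum_(H in Fac G F) M (phi H))%N.
  rewrite !(bigD1 H HF) /= [psi H]ffunE eqxx -addSn; apply: leq_add.
    exact: flat_rk_proper.
  by apply: leq_sum => X /andP[_ XH]; rewrite ffunE (negPf XH).
move=> h; rewrite -ltnS; exact: leq_trans h len.
Qed.

(** One inequality is subadditivity of the rank; the other is [fac_prod_rk] at the top element of
    the product. *)
Lemma rk_Fac : M F = (\sum_(H in Fac G F) M H)%N.
Proof.
apply/eqP; rewrite eqn_leq -{1}cover_Fac rk_cover /=.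
pose phi : {ffun {set E} -> {set E}} := [ffun X => if X \in Fac G F then X else set0].
have hphi : fac_prod M G F phi.
  apply/forallP => X; rewrite ffunE; case: (boolP (X \in Fac G F)) => // XF.
  by have [XG _ _] := mem_Fac XF; rewrite building_flat /=.
have eF : \bigcup_(H in Fac G F) phi H = F.
  by rewrite -[RHS]cover_Fac; apply: eq_bigr => H HF; rewrite ffunE HF.
have es : (\sum_(H in Fac G F) M (phi H) = \sum_(H in Fac G F) M H)%N.
  by apply: eq_bigr => H HF; rewrite ffunE HF.
by have := fac_prod_rk hphi (leqnn _); rewrite fac_joinE eF es closure_flat.
Qed.

End Factors.

(** Distinct factors of the join are disjoint, so two intersecting members lie below the same
    factor, which must be the whole join. *)
Lemma building_join F H : F \in G -> H \in G -> F :&: H != set0 ->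
  closure M (F :|: H) \in G.
Proof.
move=> FG HG FH; set K := closure M _.
have FK : F \subset K by apply: subset_trans (sub_closure _ _); apply: subsetUl.
have HK : H \subset K by apply: subset_trans (sub_closure _ _); apply: subsetUr.
have flK : flat M K by apply: flat_closure.
have K0 : K != set0 by apply: contraNneq (building_neq0 FG) => e; rewrite e subset0 in FK.
have [X XK FX] := sub_Fac FG FK; have [Y YK HY] := sub_Fac HG HK.
have [eXY|XY] := eqVneq X Y; last first.
  case/set0Pn: FH => i /setIP[iF iH].
  have /setP/(_ i) := Fac_disjoint flK K0 XK YK XY.
  by rewrite !inE (subsetP FX) ?(subsetP HY).
have [XG XsK _] := mem_Fac XK.
suff -> : K = X by [].
apply/eqP; rewrite eqEsubset XsK andbT; apply: closure_min; first exact: building_flat.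
by rewrite subUset FX eXY HY.
Qed.

(** The maximal members of [T] form an antichain with the same union; since its join is in [G],
    nestedness leaves room for only one of them. *)
Lemma nested_cover S T H : nested M G S -> T \subset S -> cover T = H -> H \in G -> H \in T.
Proof.
case/andP=> _ /forallP hS TS eT HG.
pose T' := [set X in T | [forall Y in T, (X \subset Y) ==> (X == Y)]].
have T'T : T' \subset T by apply/subsetP => X; rewrite inE => /andP[].
have cT' : cover T' = H.
  apply/eqP; rewrite -eT eqEsubset; apply/andP; split.
    by apply/bigcupsP => X /(subsetP T'T) XT; apply: bigcup_sup.
  apply/bigcupsP => X XT.
  have /maxset_exists[Y /maxsetP[/= YT mY] XY] : [pred X : {set E} | X \in T] X by [].
  apply: subset_trans XY _; apply: bigcup_sup; rewrite inE YT.
  by apply/forallP => Z; apply/implyP => ZT; apply/implyP => YZ; rewrite (mY Z).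
have anti : antichain T'.
  apply/forallP => X; apply/implyP; rewrite inE => /andP[XT /forallP mX].
  apply/forallP => Y; apply/implyP => /(subsetP T'T) YT.
  by have := mX Y; rewrite YT.
have := hS T'; rewrite (subset_trans T'T TS) anti andbT /= /joinF cT'.
rewrite closure_flat ?building_flat // HG implybF -leqNgt => le1.
have [e|[X XT']] := set_0Vmem T'.
  by have := building_neq0 HG; rewrite -cT' e /cover big_set0 eqxx.
have eT' : T' = [set X] by apply/esym/eqP; rewrite eqEcard sub1set XT' cards1.
by apply: (subsetP T'T); rewrite -cT' eT' /cover big_set1 inE.
Qed.

Lemma nested_small S : S \subset G :\ setT -> (#|S| <= 1)%N -> nested M G S.
Proof.
move=> SG c; apply/andP; split=> //; apply/forallP => T; apply/implyP => /and3P[TS cT _].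
by have := leq_trans cT (subset_leq_card TS); rewrite ltnNge c.
Qed.

Lemma nested_laminar S F H : nested M G S -> F \in S -> H \in S ->
  [\/ F \subset H, H \subset F | F :&: H = set0].
Proof.
move=> /andP[SG /forallP hS] FS HS.
have [FH|FH] := boolP (F \subset H); first by constructor 1.
have [HF|HF] := boolP (H \subset F); first by constructor 2.
constructor 3; apply/eqP; apply: contraT => FH0.
have mG X : X \in S -> X \in G by move/(subsetP SG); rewrite inE => /andP[].
have := hS [set F; H]; rewrite subUset !sub1set FS HS /= cards2.
have -> : F != H by apply: contraNneq FH => ->.
have -> /= : antichain [set F; H].
  apply/forallP => X; apply/implyP => XFH; apply/forallP => Y; apply/implyP => YFH.
  move: XFH YFH; rewrite !inE.
  by move=> /orP[] /eqP-> /orP[] /eqP->; rewrite ?eqxx ?implybT // ?(negPf FH) ?(negPf HF).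
rewrite /joinF /cover big_setU1 ?big_set1 ?inE /= ?building_join ?mG //.
by apply: contraNneq FH => ->.
Qed.

(* Removing a largest member leaves its private point outside all the others. *)
Lemma triangular_solution T (a : {set E} -> int) :
  (forall F H, F \in T -> H \in T -> [\/ F \subset H, H \subset F | F :&: H = set0]) ->
  (forall F, F \in T -> exists2 i, i \in F & forall H, H \in T -> H \proper F -> i \notin H) ->
  exists m : {ffun E -> int}, forall F, F \in T -> pairing m F = a F.
Proof.
have [n] := ubnP #|T|; elim: n T => // n IHn T; rewrite ltnS => leT lam priv.
have [->|[F1 F1T]] := set_0Vmem T; first by exists 0 => F; rewrite inE.
case: (@arg_maxnP _ F1 (fun F => F \in T) (fun F => #|F|) F1T) => F FT maxF.
have [|F' H|F' |m hm] := IHn (T :\ F).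
- by apply: leq_trans leT; rewrite [X in (_ < X)%N](cardsD1 F) FT.
- by rewrite !inE => /andP[_ F'T] /andP[_ HT]; apply: lam.
- rewrite !inE => /andP[_ F'T]; have [i iF' hi] := priv F' F'T.
  by exists i => // H; rewrite !inE => /andP[_ HT]; apply: hi.
have [i iF hi] := priv F FT.
exists (m + [ffun j => if j == i then a F - pairing m F else 0]) => H HT.
rewrite pairingD; have [->|HF] := eqVneq H F.
  rewrite {2}/pairing (bigD1 i) //= ffunE eqxx big1 ?addr0; last first.
    by move=> j /andP[_ ji]; rewrite ffunE (negPf ji).
  by rewrite addrC subrK.
rewrite hm ?inE ?HF // {1}/pairing big1 ?addr0 // => j jH; rewrite ffunE.
case: eqP => // ji; move: jH; rewrite ji => iH.
case: (lam F H FT HT) => [FH|HF'|FH].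
- have /eqP : F == H by rewrite eqEcard FH; apply: maxF.
  by move/esym/eqP; rewrite (negPf HF).
- by have := hi H HT; rewrite properEneq HF HF' iH; move/(_ isT).
- by move/setP/(_ i): FH; rewrite !inE iF iH.
Qed.

Section WithTop.
Hypothesis topG : setT \in G.

Lemma nested_neqT S F : nested M G S -> F \in S -> F \in G /\ F != setT.
Proof. by move=> /andP[/subsetP SG _] /SG; rewrite !inE => /andP[]. Qed.

(** If smaller members covered [F], then [nested_cover] would make [F] one of them. [F] need only
    lie in [G], so [setT] is allowed: this gives [nested_outside]. *)
Lemma nested_private S F : nested M G S -> F \in G ->
  exists2 i, i \in F & forall H, H \in S -> H \proper F -> i \notin H.
Proof.
move=> hS FG; pose T := [set X in S | X \proper F].
have TS : T \subset S by apply/subsetP => X; rewrite inE => /andP[].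
have /subsetPn[i iF iT] : ~~ (F \subset cover T).
  apply/negP => Fc; have e : cover T = F.
    apply/eqP; rewrite eqEsubset Fc andbT; apply/bigcupsP => X.
    by rewrite inE => /andP[_ /proper_sub].
  by have := nested_cover hS TS e FG; rewrite inE properxx andbF.
exists i => // H HS HF; apply: contra iT => iH.
by apply/bigcupP; exists H; rewrite // inE HS.
Qed.

Lemma nested_outside S : nested M G S -> exists i, forall H, H \in S -> i \notin H.
Proof.
move=> hS; have [i _ hi] := nested_private hS topG; exists i => H HS.
by apply: hi => //; rewrite properT; case: (nested_neqT hS HS).
Qed.

(** Unimodularity of the cone. Adding [setT] with prescribed value 0 to the system forces the
    solution to be a character. *)
Lemma exists_local_equation S (a : {set E} -> int) : nested M G S ->
  exists m, local_equation a S m.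
Proof.
move=> hS.
have [F H||m hm] := @triangular_solution (setT |: S) (fun F => if F == setT then 0 else a F).
- rewrite !in_setU1 => /orP[/eqP->|FS] /orP[/eqP->|HS].
  + by constructor 1.
  + by constructor 2; apply: subsetT.
  + by constructor 1; apply: subsetT.
  + exact: nested_laminar hS FS HS.
- move=> F; rewrite in_setU1 => FS.
  have FG : F \in G by case/orP: FS => [/eqP->|/(nested_neqT hS)[]].
  have [i iF hi] := nested_private hS FG; exists i => // H; rewrite in_setU1.
  by case/orP=> [/eqP->|/hi//]; rewrite properE subsetT andbF.
exists m; split; first by apply/characterE; rewrite hm ?setU11 // eqxx.
move=> F FS; rewrite hm; last by rewrite in_setU1 FS orbT.
by case: (nested_neqT hS FS) => _ /negPf->.
Qed.

(** A point outside all members of [S] gives [d <= 0], and a point outside [H] gives [0 <= d]. With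
    [d = 0], [H] is the union of the members with nonzero coefficient. *)
Lemma in_cone_cover S H : nested M G S -> H != setT -> in_cone S H ->
  exists2 T : {set {set E}}, T \subset S & cover T = H.
Proof.
move=> hS HT [c [d [c0 hc]]].
have [i0 hi0] := nested_outside hS.
have /subsetPn[i1 _ i1H] : ~~ (setT \subset H).
  by apply: contraNN HT => TH; rewrite eqEsubset subsetT.
have e0 : (i0 \in H)%:R + d = 0.
  by rewrite -hc big1 // => F FS; rewrite (negPf (hi0 F FS)) mulr0.
have d0 : 0 <= d.
  have <- : (i1 \in H)%:R + d = d by rewrite (negPf i1H) add0r.
  by rewrite -hc; apply: sumr_ge0 => F FS; rewrite mulr_ge0 ?c0 ?ler0n.
have {e0 d0} d0 : d = 0.
  apply/eqP; rewrite eq_le d0 andbT -oppr_ge0.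
  by have -> : - d = (i0 \in H)%:R by apply/eqP; rewrite eq_sym -subr_eq0 opprK e0.
exists [set F in S | c F != 0]; first by apply/subsetP => F; rewrite inE => /andP[].
apply/setP => i; have := hc i; rewrite d0 addr0 => hi.
apply/bigcupP/idP => [[F]|iH].
  rewrite inE => /andP[FS cF] iF; apply: contraT => iH.
  move: hi; rewrite (negPf iH) => /eqP; rewrite psumr_eq0 => [|X XS]; last first.
    by rewrite mulr_ge0 ?c0 ?ler0n.
  by move=> /allP/(_ F); rewrite mem_index_enum FS iF mulr1 (negPf cF) => /(_ isT).
have [h|/existsPn h] := boolP [exists F in S, (c F != 0) && (i \in F)].
  by have /existsP[F /and3P[FS cF iF]] := h; exists F; rewrite // inE FS.
move: hi; rewrite iH big1 => [/eqP|F FS]; first by rewrite eq_sym oner_eq0.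
have := h F; rewrite FS /= negb_and negbK => /orP[/eqP->|/negPf->]; first by rewrite mul0r.
by rewrite mulr0.
Qed.

Lemma in_cone_mem S H : nested M G S -> H \in G -> H != setT -> in_cone S H -> H \in S.
Proof.
move=> hS HG HT /(in_cone_cover hS HT)[T TS cT].
by apply: (subsetP TS); apply: nested_cover hS TS cT HG.
Qed.

(** [F] is a union of members of [S]. Each of them lies in one factor and the factors are disjoint,
    so each factor is itself such a union and belongs to [S] by [nested_cover]. *)
Lemma in_cone_Fac S F : flat M F -> F != set0 -> nested M G S -> F != setT -> in_cone S F ->
  Fac G F \subset S.
Proof.
move=> flF F0 hS FT /(in_cone_cover hS FT)[T TS cT].
apply/subsetP => H HF; have [HG HsF _] := mem_Fac HF.
pose T' := [set X in T | X \subset H].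
have T'T : T' \subset T by apply/subsetP => X; rewrite inE => /andP[].
apply: (subsetP (subset_trans T'T TS)); apply: nested_cover (subset_trans T'T TS) _ HG => //.
apply/eqP; rewrite eqEsubset; apply/andP; split.
  by apply/bigcupsP => X; rewrite inE => /andP[].
apply/subsetP => i iH; have := subsetP HsF i iH; rewrite -cT => /bigcupP[X XT iX].
apply/bigcupP; exists X => //; rewrite inE XT /=.
have XF : X \subset F by rewrite -cT; apply: bigcup_sup.
have [XG _] := nested_neqT hS (subsetP TS _ XT).
have [K KF XK] := sub_Fac XG XF.
have [<- //|KH] := eqVneq K H.
have /setP/(_ i) := Fac_disjoint flF F0 KF HF KH.
by rewrite !inE iH (subsetP XK).
Qed.

(** A join of several factors stays inside [F]; were it in [G], maximality would make it equal to
    each of them. *)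
Lemma nested_Fac F : flat M F -> F \notin G -> nested M G (Fac G F).
Proof.
move=> flF FG; apply/andP; split.
  apply/subsetP => H /mem_Fac[HG HF _]; rewrite !inE HG andbT.
  by apply: contraNneq FG => HT; rewrite HT subTset in HF; rewrite (eqP HF).
apply/forallP => T; apply/implyP => /and3P[TF /card_gt1P[X [Y [XT YT XY]]] _].
apply: contraNN XY => JG.
have JF : joinF M T \subset F.
  by apply: closure_min => //; apply/bigcupsP => Z /(subsetP TF) /mem_Fac[].
have eJ Z : Z \in T -> joinF M T = Z.
  move=> ZT; have [_ _] := mem_Fac (subsetP TF _ ZT); apply=> //.
  by apply: subset_trans (sub_closure _ _); apply: bigcup_sup.
by rewrite -(eJ X XT) -(eJ Y YT).
Qed.

Lemma in_cone_FacF F : flat M F -> F != set0 -> in_cone (Fac G F) F.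
Proof.
move=> flF F0; exists (fun=> 1), 0; split=> // i; rewrite addr0.
rewrite -{2}(cover_Fac flF F0); case: (boolP (i \in _)) => [/bigcupP[H HF iH]|h].
  rewrite (bigD1 H) //= iH mulr1 big1 ?addr0 // => K /andP[KF KH].
  have /setP/(_ i) := Fac_disjoint flF F0 KF HF KH.
  by rewrite !inE iH andbT => ->; rewrite mulr0.
rewrite big1 // => H HF; rewrite mul1r; case: (boolP (i \in H)) => // iH.
by case/negP: h; apply/bigcupP; exists H.
Qed.

End WithTop.

Lemma pairing_Fac F (m : {ffun E -> int}) : flat M F -> F != set0 ->
  pairing m F = \sum_(H in Fac G F) pairing m H.
Proof.
move=> flF F0; rewrite /pairing -{1}(cover_Fac flF F0).
exact: (big_trivIset _ (trivIset_Fac flF F0)).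
Qed.

End Building.

(** * The determinant on K_0 *)

Section InvertibleIdeals.
Variables (L : fieldType) (R : L -> Prop) (hR : subring R).
Implicit Types (I J K : L -> Prop).

Local Notation submod I := (submodule (V := L^o) R I).

Lemma ideal_mul_gen I J a b : I a -> J b -> ideal_mul R I J (a * b).
Proof. by move=> Ia Jb; apply: (lspan_gen hR); exists a, b. Qed.

Lemma ideal_mul_min I J K : submod K -> (forall a b, I a -> J b -> K (a * b)) ->
  forall x, ideal_mul R I J x -> K x.
Proof. by move=> hK h; apply: (lspan_min hR hK) => _ [a [b [Ia Jb ->]]]; apply: h. Qed.

Lemma submod_mull K a : submod K -> submod (fun x => K (a * x)).
Proof.
move=> hK; split=> [|c u v Rc Ku Kv]; first by rewrite mulr0; case: hK.
by rewrite mulrDr scale_reg mulrCA; apply: hK.2.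
Qed.

Lemma ideal_mulC I J : ideal_mul R I J = ideal_mul R J I.
Proof.
apply/funext => x; apply/propext; split; apply: ideal_mul_min x => [|a b Ia Jb];
  rewrite 1?mulrC; by [apply: ideal_mul_submod | apply: ideal_mul_gen].
Qed.

Lemma ideal_mul_assoc_sub I J K x :
  ideal_mul R I (ideal_mul R J K) x -> ideal_mul R (ideal_mul R I J) K x.
Proof.
apply: ideal_mul_min => [|a b Ia]; first exact: ideal_mul_submod.
apply: (ideal_mul_min (submod_mull a (ideal_mul_submod hR _ _))) => c d Jc Kd.
by rewrite mulrA; apply: ideal_mul_gen => //; apply: ideal_mul_gen.
Qed.

Lemma ideal_mulA I J K :
  ideal_mul R I (ideal_mul R J K) = ideal_mul R (ideal_mul R I J) K.
Proof.
apply/funext => x; apply/propext; split; first exact: ideal_mul_assoc_sub.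
(* The reverse inclusion is the first one with the factors in opposite order, read through
   commutativity. *)
have := @ideal_mul_assoc_sub K J I x.
by rewrite (ideal_mulC J I) (ideal_mulC K (ideal_mul R I J)) (ideal_mulC K J)
  (ideal_mulC (ideal_mul R J K) I).
Qed.

Lemma ideal_mul1 I : submod I -> ideal_mul R R I = I.
Proof.
move=> hI; apply/funext => x; apply/propext; split=> [|Ix].
  by apply: (ideal_mul_min hI) => a b Ra Ib; apply: (submodZ hI).
by rewrite -[x]mul1r; apply: ideal_mul_gen => //; apply: subring1.
Qed.

Definition invertible I : Prop := submod I /\ ideal_mul R I (ideal_dual R I) 1.

Lemma ideal_mul_dual I : invertible I -> ideal_mul R (ideal_dual R I) I = R.
Proof.
move=> [hI I1]; apply/funext => x; apply/propext; split.
  by apply: (ideal_mul_min (submodule_self hR)) => a b; apply.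
move=> Rx; rewrite ideal_mulC -[x]mulr1.
exact: (submodZ (ideal_mul_submod hR _ _) (v := (1 : L^o))).
Qed.

Lemma invertible_mul I J : invertible I -> invertible J -> invertible (ideal_mul R I J).
Proof.
move=> hI hJ; split; first exact: ideal_mul_submod.
have dm : forall x, ideal_mul R (ideal_dual R I) (ideal_dual R J) x ->
    ideal_dual R (ideal_mul R I J) x.
  apply: ideal_mul_min => [|a b Ia Jb]; first exact: ideal_dual_submod.
  apply: (ideal_mul_min (submod_mull _ (submodule_self hR))) => c d Ic Jd.
  by rewrite mulrACA; apply: subringM => //; [apply: Ia | apply: Jb].
have : ideal_mul R (ideal_mul R (ideal_dual R I) I) (ideal_mul R (ideal_dual R J) J) 1.
  rewrite !ideal_mul_dual // -[1]mulr1; apply: ideal_mul_gen; exact: subring1.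
rewrite (ideal_mulC (ideal_dual R I) I) -(ideal_mulA I) (ideal_mulA (ideal_dual R I)).
rewrite (ideal_mulC _ J) ideal_mulA.
apply: ideal_mul_min => [|a b Ia Jb]; first exact: ideal_mul_submod.
by apply: ideal_mul_gen => //; apply: dm.
Qed.

Lemma invertible_dual I : invertible I -> invertible (ideal_dual R I).
Proof.
move=> hI; split; first exact: ideal_dual_submod.
have : ideal_mul R (ideal_dual R I) I 1 by rewrite ideal_mul_dual //; apply: subring1.
apply: ideal_mul_min => [|a b Ia Ib]; first exact: ideal_mul_submod.
by apply: ideal_mul_gen => // c hc; rewrite mulrC; apply: hc.
Qed.

Definition principal_ideal (d : L) : L -> Prop := fun v => R (v / d).

Lemma principal_submod d : submod (principal_ideal d).
Proof.
rewrite /principal_ideal; split=> [|c u v Rc Ru Rv]; first by rewrite mul0r; apply: subring0.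
by rewrite mulrDl scale_reg -mulrA; apply: subringD => //; apply: subringM.
Qed.

Lemma principal_ideal1 : principal_ideal 1 = R.
Proof. by apply/funext => v; rewrite /principal_ideal divr1. Qed.

Lemma principal_mul d I v : d != 0 -> submod I ->
  ideal_mul R (principal_ideal d) I v <-> I (v / d).
Proof.
move=> d0 hI; split.
  have hI' : submod (fun v => I (v / d)).
    split=> [|c x y Rc Ix Iy]; first by rewrite mul0r; case: hI.
    by rewrite mulrDl scale_reg -mulrA; apply: hI.2.
  apply: (ideal_mul_min hI') => a b Ra Ib.
  by rewrite mulrAC; apply: (submodZ hI).
move=> Iv; have -> : v = d * (v / d) by rewrite mulrC divfK.
apply: ideal_mul_gen => //.
by rewrite /principal_ideal divff //; apply: subring1.
Qed.

Lemma principal_ideal_mul d e : d != 0 -> e != 0 ->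
  ideal_mul R (principal_ideal d) (principal_ideal e) = principal_ideal (d * e).
Proof.
move=> d0 e0; apply/funext => v; apply/propext;
rewrite principal_mul //; last exact: principal_submod.
by rewrite /principal_ideal invfM mulrA.
Qed.

Lemma principal_invertible d : d != 0 -> invertible (principal_ideal d).
Proof.
move=> d0; split; first exact: principal_submod.
rewrite -(divff d0); apply: ideal_mul_gen.
  by rewrite /principal_ideal divff //; apply: subring1.
by move=> g; rewrite /principal_ideal mulrC.
Qed.

Lemma locally_principal_invertible I : locally_principal R I -> invertible I.
Proof.
move=> lp; have [hI [s hs pr]] := lp; split=> //.
apply: (cover_local (V := L^o) hR (ideal_mul_submod hR _ _) hs) => x xs.
have [Rx x0] := hs.1 x xs; have [d pd] := pr x xs.
have [_ h] := principal_at_mul hR Rx x0 pd (ideal_dual_principal_at hR lp Rx x0 pd).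
have d0 := pd.1.
apply/h; rewrite divff // divr1; apply: localize_self; exact: subring1.
Qed.

Lemma covers1 : covers R [:: 1].
Proof.
split=> [x|]; first by rewrite inE => /eqP->; split; [apply: subring1 | apply: oner_neq0].
exists (fun=> 1) => [x _|]; first exact: subring1.
by rewrite big_seq1 mulr1.
Qed.

Lemma principal_locally_free d : d != 0 ->
  locally_free R (fun v : 'rV[L]_1 => principal_ideal d (v 0 0)).
Proof.
move=> d0; apply/locally_freeP; split.
  by split=> [|a u v Ra Iu Iv]; rewrite !mxE;
    [case: (principal_submod d) | apply: (principal_submod d).2].
exists [:: 1]; first exact: covers1.
move=> x; rewrite inE => /eqP->; exists d%:M.
suff /principal_at_free[] : principal_at R 1 (principal_ideal d) d by [].
split=> // v; split=> -[N h]; exists N; move: h; rewrite expr1n.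
  by rewrite !scale1r.
by rewrite !scale1r.
Qed.

Lemma det_ideal_line I : submod I ->
  det_ideal R (fun v : 'rV[L]_1 => I (v 0 0)) = I.
Proof.
move=> hI; apply/funext => x; apply/propext; split=> [|Ix].
  apply: (lspan_min hR hI) => _ [B hB ->].
  by have := hB 0; rewrite det_mx11 mxE.
apply: (lspan_gen hR); exists x%:M; last by rewrite det_scalar1.
by move=> i; rewrite ord1 !mxE eqxx.
Qed.

End InvertibleIdeals.

Lemma zmod_morphism_sum (U V : zmodType) (f : U -> V) (hf : zmod_morphism f)
  (I : Type) (r : seq I) (F : I -> U) : f (\sum_(i <- r) F i) = \sum_(i <- r) f (F i).
Proof.
have f0 : f 0 = 0 by rewrite -(subrr 0) hf subrr.
apply: (big_morph f _ f0) => x y.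
by rewrite -[y in LHS]opprK hf -[- y]sub0r hf f0 sub0r opprK.
Qed.

Lemma div_neq0 (L : fieldType) (f g : L) : f != 0 -> g != 0 -> f / g != 0.
Proof. by move=> f0 g0; rewrite mulf_neq0 ?invr_eq0. Qed.

(** * Families of invertible ideals modulo global principal ones *)

Section PicardGroup.
Variables (L : fieldType) (T : Type).
Variable RR : {R : T -> L -> Prop | forall t, subring (R t)}.
Local Notation R := (sval RR).
Local Notation hR := (svalP RR).

(** The ideals for different [t] are not tied together, so [Pic] may exceed the Picard group of X;
    it serves as the target of determinants. *)
Record invline := InvLine {
  il_sec : T -> L -> Prop;
  il_invertible : forall t, invertible (R t) (il_sec t) }.

HB.instance Definition _ := gen_eqMixin invline.
HB.instance Definition _ := gen_choiceMixin invline.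

Lemma invline_eq (a b : invline) : (forall t, il_sec a t = il_sec b t) -> a = b.
Proof.
case: a b => [a ha] [b hb] /= /funext e; subst b.
by congr InvLine; apply: Prop_irrelevance.
Qed.

Lemma il_submod (a : invline) t : submodule (V := L^o) (R t) (il_sec a t).
Proof. by case: (il_invertible a t). Qed.

Definition il_principal f (f0 : f != 0) : invline :=
  @InvLine (fun t => principal_ideal (R t) f)
    (fun t => principal_invertible (hR t) f0).
Definition il_zero := il_principal (oner_neq0 L).
Definition il_add (a b : invline) : invline :=
  @InvLine (fun t => ideal_mul (R t) (il_sec a t) (il_sec b t))
    (fun t => invertible_mul (hR t) (il_invertible a t) (il_invertible b t)).
Definition il_opp (a : invline) : invline :=
  @InvLine (fun t => ideal_dual (R t) (il_sec a t))
    (fun t => invertible_dual (hR t) (il_invertible a t)).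

Lemma il_addA : associative il_add.
Proof. by move=> a b c; apply: invline_eq => t; apply/ideal_mulA/hR. Qed.
Lemma il_addC : commutative il_add.
Proof. by move=> a b; apply: invline_eq => t; apply/ideal_mulC/hR. Qed.
Lemma il_add0 : left_id il_zero il_add.
Proof.
move=> a; apply: invline_eq => t /=; rewrite principal_ideal1.
exact: (ideal_mul1 (hR _) (il_submod a t)).
Qed.
Lemma il_addN : left_inverse il_zero il_opp il_add.
Proof.
move=> a; apply: invline_eq => t /=; rewrite principal_ideal1.
exact: (ideal_mul_dual (hR _) (il_invertible a t)).
Qed.

HB.instance Definition _ := GRing.isZmodule.Build invline il_addA il_addC il_add0 il_addN.

Lemma il_secD a b t : il_sec (a + b) t = ideal_mul (R t) (il_sec a t) (il_sec b t).
Proof. by []. Qed.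
Lemma il_secN a t : il_sec (- a) t = ideal_dual (R t) (il_sec a t).
Proof. by []. Qed.
Lemma il_sec0 t : il_sec 0 t = R t.
Proof. exact: (principal_ideal1 (R t)). Qed.
Lemma il_sec_principal f (f0 : f != 0) t :
  il_sec (il_principal f0) t = principal_ideal (R t) f.
Proof. by []. Qed.

Definition principal : {pred invline} :=
  fun a => `[< exists f, exists f0 : f != 0, a = il_principal f0 >].

Lemma il_principal_mul f g (f0 : f != 0) (g0 : g != 0) (fg0 : f * g != 0) :
  il_principal f0 + il_principal g0 = il_principal fg0.
Proof.
apply: invline_eq => t; rewrite il_secD !il_sec_principal.
exact: (principal_ideal_mul (hR t) f0 g0).
Qed.

Lemma principal_closed : zmod_closed principal.
Proof.
split; first by apply/asboolP; exists 1, (oner_neq0 _).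
move=> a b /asboolP[f [f0 ->]] /asboolP[g [g0 ->]]; apply/asboolP.
have fg0 : f / g != 0 := div_neq0 f0 g0.
exists (f / g), fg0; apply: (addIr (il_principal g0)); rewrite subrK.
have h : f / g * g != 0 := mulf_neq0 fg0 g0.
by rewrite (il_principal_mul _ _ h); apply: invline_eq => t; rewrite !il_sec_principal divfK.
Qed.

HB.instance Definition _ := GRing.isZmodClosed.Build invline principal principal_closed.

Definition Pic : zmodType := @Quotient.quot invline principal.
Definition Pic_pi (a : invline) : Pic := (\pi a)%qT.

Lemma Pic_pi_is_zmod_morphism : zmod_morphism Pic_pi.
Proof. exact: (raddfB (\pi_Pic)%qT). Qed.

HB.instance Definition _ := GRing.isZmodMorphism.Build invline Pic Pic_pi Pic_pi_is_zmod_morphism.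

(** One function [f] serves all [t], so equality in [Pic] is exactly the relation [line_iso]. *)
Lemma Pic_eq (a b : invline) : Pic_pi a = Pic_pi b <->
  exists2 f, f != 0 & forall t v, il_sec a t v <-> il_sec b t (v / f).
Proof.
have key (f : L) (f0 : f != 0) : a = il_principal f0 + b <->
    forall t v, il_sec a t v <-> il_sec b t (v / f).
  have mulE t v := principal_mul (hR t) v f0 (il_submod b t).
  split=> [-> t v|h]; first by rewrite il_secD il_sec_principal.
  apply: invline_eq => t; apply/funext => v; apply/propext.
  by rewrite h il_secD il_sec_principal mulE.
apply: (iff_trans (B := is_true (a - b \in principal))).
  by rewrite Quotient.idealrBE; split=> [e|/eqP//]; apply/eqP.
split=> [/asboolP[f [f0 e]]|[f f0 h]].
  by exists f => //; apply/(key f f0); rewrite -e subrK.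
by apply/asboolP; exists f, f0; apply: (canLR (addrK b)); apply/key.
Qed.

End PicardGroup.

(** * The determinant homomorphism from K_0 *)

Section PicardOfChart.
Variables (k : fieldType) (E : finType) (M : matroid E) (G : {set {set E}}).
Local Notation L := (ratfun k E).
Local Notation R := (@chart_ring k E).
Local Notation chart := {S : {set {set E}} | nested M G S}.
Definition chart_rings : {R : chart -> L -> Prop | forall t, subring (R t)} :=
  exist (fun R : chart -> L -> Prop => forall t, subring (R t))
    (fun t : chart => R (val t)) (fun t : chart => chart_subring k (val t)).
Local Notation invline := (invline chart_rings).
Local Notation Pic := (Pic chart_rings).
Local Notation bundle := (bundle k M G).
Local Notation bundle_group := (bundle_group k M G).
Local Notation K0 := (K0 k M G).

Lemma det_line_invertible (P : bundle) (t : chart) :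
  invertible (R (val t)) (det_sheaf (sval P) (val t)).
Proof.
apply: locally_principal_invertible; first exact: chart_subring.
apply: det_locally_principal; first exact: chart_subring.
by case: (svalP P) => h _; apply: h; apply: (valP t).
Qed.

Definition det_line (P : bundle) : invline :=
  @InvLine _ _ chart_rings _ (@det_line_invertible P).

(** Written as a sum over the support to match [K_det] term by term; additivity comes from the
    identification with [fglift]. *)
Definition Det (x : bundle_group) : invline :=
  \sum_(P <- dom x) det_line P *~ coeff P x.

Lemma Det_fglift x : Det x = fglift (det_line : {classic bundle} -> zmodule invline) x.
Proof.
rewrite -[in RHS](freeg_sumE x) /Det.
rewrite (zmod_morphism_sum (lift_is_additive (_ : {classic bundle} -> zmodule invline))).
by apply: eq_bigr => P _; rewrite liftU.
Qed.

Lemma DetB x y : Det (x - y) = Det x - Det y.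
Proof.
rewrite !Det_fglift.
exact: (lift_is_additive (det_line : {classic bundle} -> zmodule invline) x y).
Qed.

Lemma Det_gen P : Det (gen P) = det_line P.
Proof. by rewrite Det_fglift /gen liftU. Qed.

Lemma Det_exact (P' P P'' : bundle) : short_exact M G (sval P') (sval P) (sval P'') ->
  Pic_pi (det_line P) = Pic_pi (det_line P') + Pic_pi (det_line P'').
Proof.
move=> [A [B hAB]]; rewrite -raddfD; apply/Pic_eq.
(* The torus chart supplies the ranks and the splitting [h0], which are then used on all charts. *)
have t0 : nested M G set0 := nested0 M G.
have ex t (nt : nested M G t) : exact_on (sec (s := sval P') t) (sec (s := sval P) t)
   (sec (s := sval P'') t) A B by have [] := hAB t nt.
have lf (Q : bundle) t (nt : nested M G t) : locally_free (R t) (sec (s := sval Q) t).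
  by case: (svalP Q) => h _; apply: h.
have [en [h0 h0B]] := exact_rank_section (chart_subring k set0)
  (lf P' _ t0) (lf P _ t0) (lf P'' _ t0) (ex _ t0).
(* The middle bundle is taken apart so that its rank can be replaced by the sum of the outer ranks,
   the form that [det_exact] requires. *)
move: P' P P'' A B hAB ex lf en h0 h0B.
move=> P' [[n sc] hP] P'' A B hAB ex lf /= en; subst n => h0 h0B.
have hdet t (nt : nested M G t) := det_exact (chart_subring k t)
  (lf P' _ nt) (lf (exist _ _ hP) _ nt) (lf P'' _ nt) (ex _ nt) h0B.
exists (\det (col_mx A h0)); first by case: (hdet _ t0).
by move=> [t nt] v; case: (hdet t nt) => _; apply.
Qed.

Lemma Det_K_subgroup x : x \in @K_subgroup k E M G -> Pic_pi (Det x) = 0.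
Proof.
move=> /asboolP/(_ (fun x => Pic_pi (Det x) = 0)); apply.
- by rewrite -[0]subr0 DetB Pic_pi_is_zmod_morphism subrr.
- by move=> y z hy hz; rewrite DetB Pic_pi_is_zmod_morphism hy hz subrr.
- move=> _ [P' P P'' /Det_exact h]; rewrite !DetB !Pic_pi_is_zmod_morphism !Det_gen h.
  by rewrite -addrA -opprD subrr.
Qed.

Definition pic (xi : K0) : Pic := Pic_pi (Det (repr xi)).

(** Independence of the representative chosen in [pic], hence also of the one chosen in [K_det]. *)
Lemma pic_pi x : pic (K_pi x) = Pic_pi (Det x).
Proof.
apply/eqP; rewrite -subr_eq0 -Pic_pi_is_zmod_morphism -DetB; apply/eqP/Det_K_subgroup.
by rewrite Quotient.idealrBE /K_pi reprK.
Qed.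

Lemma pic_is_zmod_morphism : zmod_morphism pic.
Proof.
move=> xi eta; rewrite -[xi]reprK -[eta]reprK.
rewrite -[X in pic X](raddfB (\pi_K0)%qT) -!/(K_pi _) !pic_pi.
by rewrite DetB Pic_pi_is_zmod_morphism.
Qed.

HB.instance Definition _ := GRing.isZmodMorphism.Build K0 Pic pic pic_is_zmod_morphism.

Lemma line_pow_il (l : line k E) (a : invline) z (t : chart) :
  l (val t) = il_sec a t -> line_pow l z (val t) = il_sec (a *~ z) t.
Proof.
move=> la.
have pos n : iter n (line_tensor l) (@line1 k E) (val t) = il_sec (a *+ n) t.
  elim: n => [|n IHn]; first by rewrite mulr0n il_sec0.
  by rewrite mulrS il_secD -la -IHn.
case: z => n; first exact: pos.
by rewrite NegzE mulrNz il_secN -pos.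
Qed.

Lemma K_det_il (xi : K0) (t : chart) : K_det xi (val t) = il_sec (Det (repr xi)) t.
Proof.
rewrite /K_det /Det; elim: (dom (repr xi)) => [|P s IHs].
  by rewrite !big_nil il_sec0.
by rewrite !big_cons il_secD -IHs -(@line_pow_il (det_sheaf (sval P)) (det_line P)).
Qed.

Lemma line_isoP (l l' : line k E) (a b : invline) :
  (forall t, l (val t) = il_sec a t) -> (forall t, l' (val t) = il_sec b t) ->
  line_iso M G l l' <-> Pic_pi a = Pic_pi b.
Proof.
move=> la lb; rewrite Pic_eq; split=> -[f f0 h]; exists f^-1; rewrite ?invr_eq0 //.
  by move=> t v; rewrite -la -lb invrK mulrC; apply: h; apply: (valP t).
move=> S nS v; rewrite -[S]/(val (exist (fun S => nested M G S) S nS)) la lb h.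
by rewrite mulrC.
Qed.

Lemma pic_class P (hP : is_bundle M G P) : pic (K_class M G P) = Pic_pi (det_line (exist _ P hP)).
Proof.
rewrite /K_class; case: pselect => [h|//].
by rewrite pic_pi Det_gen (Prop_irrelevance h hP).
Qed.

Lemma dual_is_bundle (P : sheaf k E) : is_bundle M G P -> is_bundle M G (dual_sheaf P).
Proof.
move=> [lf sub]; split=> [S nS|S S' nS' SS' v].
  apply: dual_locally_free; [exact: chart_subring | | exact: lf].
  by case: (lf S nS).
have eS : sec (s := P) S = lspan (R S) (sec (s := P) S').
  by apply/funext => w; apply/propext; apply: sub.
rewrite /= -[X in X <-> _]/(dual_mod (R S) (sec (s := P) S) v) eS.
apply: dual_mod_lspan; [exact: chart_subring | | exact: chart_subring | | exact: lf].
  by case: (lf S' nS').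
by move=> a; apply: chart_sub.
Qed.

Lemma pic_dual xi : pic (K_dual xi) = - pic xi.
Proof.
rewrite /K_dual raddf_sum [in RHS]/pic /Det raddf_sum -sumrN.
apply: eq_bigr => P _; rewrite !raddfMz /=; congr (_ *~ _).
rewrite (pic_class (dual_is_bundle (svalP P))) -raddfN; congr Pic_pi.
apply: invline_eq => t; apply/funext => v; apply/propext.
apply: det_dual; first exact: chart_subring.
exact: ((svalP P).1 _ (valP t)).
Qed.

End PicardOfChart.

(** * The Chow ring in degree one *)

Lemma some_stP (T : Type) (x0 : T) (P : T -> Prop) : (exists x, P x) -> P (some_st x0 P).
Proof. by move=> h; rewrite /some_st; case: pselect => // h'; apply: svalP. Qed.

Section ChowDegreeOne.
Variables (E : finType) (M : matroid E) (G : {set {set E}}).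
Implicit Types (F H : {set E}) (a b : {set E} -> int).

Lemma divcl_ext a b : (forall F, F \in G :\ setT -> a F = b F) -> divcl M G a = divcl M G b.
Proof. by move=> h; apply: eq_bigr => F FG; rewrite h. Qed.

Lemma divclD a b : divcl M G (fun F => a F + b F) = divcl M G a + divcl M G b.
Proof. by rewrite /divcl -big_split; apply: eq_bigr => F _; rewrite mulrzDr. Qed.

Lemma divclN a : divcl M G (fun F => - a F) = - divcl M G a.
Proof. by rewrite /divcl -sumrN; apply: eq_bigr => F _; rewrite mulrNz. Qed.

Lemma alpha_divcl (i : E) : alpha M G i = divcl M G (fun F => (i \in F)%:Z).
Proof.
rewrite /alpha /divcl big_mkcondr; apply: eq_bigr => F _.
by case: (i \in F); rewrite ?mulr1z ?mulr0z.
Qed.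

Lemma x_divcl F : F \in G :\ setT -> x_ M G F = divcl M G (fun H => (H == F)%:Z).
Proof.
move=> FG; rewrite /divcl (bigD1 F) //= eqxx mulr1z big1 ?addr0 // => H /andP[_ /negPf->].
by rewrite mulr0z.
Qed.

Lemma divcl_pairing (m : {ffun E -> int}) : character m -> divcl M G (pairing m) = 0.
Proof.
(* If [E] is empty there is no [alpha] to compare with, but all pairings are empty sums. *)
move=> hm; have [i _|no] := pickP (xpredT : pred E); last first.
  rewrite /divcl big1 // => F _; rewrite /pairing big1 ?mulr0z // => j.
  by have := no j.
transitivity (\sum_(j : E) alpha M G j *~ m j).
  transitivity (\sum_(F in G :\ setT) \sum_(j in F) x_ M G F *~ m j).
    by apply: eq_bigr => F _; rewrite /pairing mulrz_sumr.
  rewrite (exchange_big_dep xpredT) //=; apply: eq_bigr => j _.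
  by rewrite /alpha mulrz_suml.
rewrite (eq_bigr (fun j => alpha M G i *~ m j)) => [|j _]; last by rewrite (alpha_indep M G j i).
by rewrite -mulrz_sumr hm mulr0z.
Qed.

Lemma mcoeff_xvar F (j : 'I_#|G :\ setT|) : (xvar G F)@_U_(j) = (enum_val j == F)%:R.
Proof.
rewrite /xvar raddf_sum /= big_mkcond (bigD1 j) //= mcoeffXU eqxx big1 ?addr0.
  by case: eqP.
by move=> l lj; case: ifP => // _; rewrite mcoeffXU (negPf lj).
Qed.

(** Polynomials without constant term whose linear part comes from a character form an ideal. It
    contains the linear relations, which come from differences of unit vectors, and the non-nested
    monomials, which have at least two factors. *)
Lemma chow_ideal_degree1 (p : chow_poly G) : p \in @chow_ideal E M G ->
  exists2 m : {ffun E -> int}, character m &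
    forall j : 'I_#|G :\ setT|, p@_U_(j) = pairing m (enum_val j).
Proof.
pose J (p : chow_poly G) := p@_0 = 0 /\ exists2 m : {ffun E -> int}, character m &
    forall j : 'I_#|G :\ setT|, p@_U_(j) = pairing m (enum_val j).
have c0M (q r : chow_poly G) : (q * r)@_0 = q@_0 * r@_0 by apply: (rmorphM (mcoeff 0%MM)).
have c1M (q r : chow_poly G) j : (q * r)@_U_(j) = q@_0 * r@_U_(j) + q@_U_(j) * r@_0.
  (* A linear coefficient is the constant term of a partial derivative, so [c1M] is the Leibniz
     rule. *)
  have D r' : (r' : chow_poly G)@_U_(j) = (r'^`M(j))@_0 by rewrite mcoeff_deriv add0m mnm0E.
  by rewrite !D mderivM mcoeffD !c0M addrC.
move=> /asboolP/(_ J) h; suff [] : J p by [].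
apply: h => [|q u v [u0 [m hm em]] [v0 [m' hm' em']]|_ [S SG nS|i j]].
- split; first exact: mcoeff0.
  by exists 0; [apply: character0 | move=> j; rewrite mcoeff0 pairing0].
- split; first by rewrite mcoeffD c0M u0 v0 mulr0 addr0.
  exists ([ffun i => q@_0 * m i] + m').
    apply: characterD => //; rewrite /character.
    by under eq_bigr do rewrite ffunE; rewrite -mulr_sumr hm mulr0.
  move=> j; rewrite mcoeffD c1M u0 mulr0 addr0 em em' pairingD; congr (_ + _).
  by rewrite /pairing mulr_sumr; apply: eq_bigr => i _; rewrite ffunE.
- have lt1 : (1 < #|S|)%N by rewrite ltnNge; apply: contraNN nS => le1; apply: nested_small.
  have /card_gt1P[F [H [FS HS FH]]] := lt1.
  rewrite (bigD1 F) //= (bigD1 H) /=; last by rewrite HS eq_sym.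
  split; first by rewrite c0M xvar_coef0 mul0r.
  exists 0; first exact: character0.
  by move=> j; rewrite !c1M !c0M !xvar_coef0 !mul0r mulr0 addr0 pairing0.
- have a0 l : (alpha_poly G l)@_0 = 0.
    by rewrite /alpha_poly raddf_sum big1 // => F _; apply: xvar_coef0.
  have a1 l (t : 'I_#|G :\ setT|) : (alpha_poly G l)@_U_(t) = (l \in enum_val t)%:R.
    rewrite /alpha_poly raddf_sum /=; under eq_bigr do rewrite mcoeff_xvar.
    rewrite big_mkcondr (bigD1 (enum_val t)) /=; last exact: enum_valP.
    rewrite eqxx big1 ?addr0; first by case: ifP.
    by move=> F /andP[_ Ft]; rewrite eq_sym (negPf Ft) if_same.
  split; first by rewrite mcoeffB !a0 subrr.
  exists ([ffun s => (s == i)%:R] - [ffun s => (s == j)%:R]).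
    by apply/characterE; rewrite pairingD pairingN !pairing_unit !inE subrr.
  by move=> t; rewrite mcoeffB !a1 pairingD pairingN !pairing_unit.
Qed.

(** A^1 is the group of torus-invariant divisors modulo divisors of characters. *)
Lemma divcl_eqP a b : divcl M G a = divcl M G b <->
  exists2 m : {ffun E -> int}, character m &
    forall F, F \in G :\ setT -> a F - b F = pairing m F.
Proof.
split=> [e|[m hm h]]; last first.
  apply/eqP; rewrite -subr_eq0 -divclN -divclD -(divcl_pairing hm).
  by apply/eqP/divcl_ext => F /h.
have pE c : divcl M G c = chow_pi M (\sum_(F in G :\ setT) xvar G F *~ c F).
  rewrite /chow_pi raddf_sum; apply: eq_bigr => F _.
  by rewrite raddfMz.
have /chow_ideal_degree1[m hm h] :
    \sum_(F in G :\ setT) xvar G F *~ a F - \sum_(F in G :\ setT) xvar G F *~ b F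
      \in @chow_ideal E M G.
  by rewrite Quotient.idealrBE; apply/eqP; rewrite -!/(chow_pi _ _) -!pE.
have cE c (j : 'I_#|G :\ setT|) :
    (\sum_(F in G :\ setT) xvar G F *~ c F : chow_poly G)@_U_(j) = c (enum_val j).
  rewrite raddf_sum /= (bigD1 (enum_val j)) /=; last exact: enum_valP.
  rewrite raddfMz /= mcoeff_xvar eqxx -[RHS]intz big1 ?addr0 // => F /andP[_ Fj].
  by rewrite raddfMz /= mcoeff_xvar eq_sym (negPf Fj) mul0rz.
exists m => // F FG; have := h (enum_rank_in FG F).
by rewrite mcoeffB !cE enum_rankK_in.
Qed.

End ChowDegreeOne.

(** * First Chern classes *)

Section Divisors.
Variables (k : fieldType) (E : finType) (M : matroid E) (G : {set {set E}}).
Hypotheses (hM : loopless M) (hG : building_set M G) (topG : setT \in G).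
Local Notation L := (ratfun k E).
Local Notation R := (@chart_ring k E).
Local Notation chart := {S : {set {set E}} | nested M G S}.
Local Notation chart_rings := (chart_rings k M G).
Implicit Types (a b : {set E} -> int) (F : {set E}).

Lemma line_div_principal a (S : {set {set E}}) m : character m ->
  (forall F, F \in S -> pairing m F = - a F) ->
  line_div a S = principal_ideal (R S) (chi k m).
Proof.
move=> hm e; apply/funext => v; apply/propext; exact: line_div_local.
Qed.

Lemma exists_line_equation a (S : {set {set E}}) : nested M G S ->
  exists2 m : {ffun E -> int}, character m & forall F, F \in S -> pairing m F = - a F.
Proof.
by move=> /(exists_local_equation hM hG topG (fun F => - a F))[m [hm e]]; exists m.
Qed.

Lemma line_div_invertible a (t : chart) : invertible (R (val t)) (line_div a (val t)).
Proof.
have [m hm e] := exists_line_equation a (valP t).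
rewrite (line_div_principal hm e).
exact: (principal_invertible (chart_subring k (val t)) (chi_neq0 k m)).
Qed.

Definition Lin a : invline chart_rings := @InvLine _ _ chart_rings _ (line_div_invertible a).

Lemma LinD (a b : {ffun {set E} -> int}) : Lin (a + b) = Lin a + Lin b.
Proof.
apply: invline_eq => t; rewrite il_secD /=.
have [m hm e] := exists_line_equation a (valP t).
have [m' hm' e'] := exists_line_equation b (valP t).
rewrite (line_div_principal hm e) (line_div_principal hm' e').
rewrite (principal_ideal_mul (chart_subring k (val t)) (chi_neq0 k m) (chi_neq0 k m')) -chiD.
apply: line_div_principal; first exact: characterD.
by move=> F FS; rewrite pairingD e // e' // ffunE opprD.
Qed.

Definition div_pic (a : {ffun {set E} -> int}) : Pic chart_rings := Pic_pi (Lin a).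

Lemma div_pic_is_zmod_morphism : zmod_morphism div_pic.
Proof.
move=> a b; apply/eqP; rewrite eq_sym subr_eq; apply/eqP.
by rewrite /div_pic -raddfD -LinD subrK.
Qed.

HB.instance Definition _ :=
  GRing.isZmodMorphism.Build {ffun {set E} -> int} _ div_pic div_pic_is_zmod_morphism.

Definition div_chow (a : {ffun {set E} -> int}) : chow M G := divcl M G a.

Lemma div_chow_is_zmod_morphism : zmod_morphism div_chow.
Proof.
move=> a b; rewrite /div_chow -divclN -divclD; apply: divcl_ext => F _.
by rewrite !ffunE.
Qed.

HB.instance Definition _ :=
  GRing.isZmodMorphism.Build {ffun {set E} -> int} _ div_chow div_chow_is_zmod_morphism.

(** By [divcl_eqP] both sides say that the divisors differ by a character. An isomorphism [f] is a
    unit on the torus, hence a monomial, and its exponent is the character up to sign. *)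
Lemma eq_linear_equivalent a b : Pic_pi (Lin a) = Pic_pi (Lin b) <-> divcl M G a = divcl M G b.
Proof.
rewrite divcl_eqP Pic_eq; split=> [[f f0 h]|[m hm e]]; last first.
  exists (chi k (- m)) => [|t v]; first exact: chi_neq0.
  have [m1 hm1 e1] := exists_line_equation b (valP t).
  rewrite /= (line_div_principal hm1 e1) (line_div_principal (m := m1 - m)).
  - by rewrite /principal_ideal addrC chiD invfM mulrA.
  - by apply: characterD => //; apply: characterN.
  - move=> F FS; have [SG _] := andP (valP t).
    have := e F (subsetP SG F FS); rewrite pairingD pairingN e1 // => <-.
    by rewrite opprB addKr.
(* Over the torus every O(D) is trivial, so [f] and its inverse are regular there. *)
have line0 c v : line_div c set0 v <-> R set0 v.
  rewrite (@line_div_principal c set0 0) ?/principal_ideal; first by rewrite chi0 divr1.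
    exact: character0.
  by move=> F; rewrite inE.
have h' S (nS : nested M G S) v : line_div a S v <-> line_div b S (v / f) := h (exist _ S nS) v.
have h0 v := h' set0 (nested0 M G) v.
have R1 := subring1 (chart_subring k (set0 : {set {set E}})).
have [c [m [c0 hm ef]]] : exists c m, [/\ c != 0, character m & f = scalar E c * chi k m].
  apply: torus_unit => //.
    by apply/(line0 a)/h0; rewrite divff //; apply/line0.
  by apply/(line0 b); rewrite -[f^-1]mul1r; apply/h0/line0.
exists (- m); first exact: characterN.
move=> F FG.
(* On the chart of the single ray [F], comparing generators in both directions yields two opposite
   inequalities for the pairing with [F]. *)
have nF : nested M G [set F] by apply: nested_small; rewrite ?sub1set ?cards1.
have [m1 hm1 e1] := exists_line_equation a nF.
have [m2 hm2 e2] := exists_line_equation b nF.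
have chi1 (m0 : {ffun E -> int}) : principal_ideal (R [set F]) (chi k m0) (chi k m0).
  rewrite /principal_ideal divff ?chi_neq0 //; exact: (subring1 (chart_subring k _)).
have le1 : 0 <= pairing (m1 - m - m2) F.
  have : line_div b [set F] (chi k m1 / f).
    by apply/(h' _ nF); rewrite (line_div_principal hm1 e1).
  rewrite (line_div_principal hm2 e2) /principal_ideal ef.
  have -> : chi k m1 / (scalar E c * chi k m) / chi k m2 =
      scalar E c^-1 * chi k (m1 - m - m2).
    have sc0 : scalar E c != 0 by rewrite scalar_eq0.
    have -> : scalar E c^-1 = (scalar E c)^-1.
      by apply: (mulIf sc0); rewrite -scalarM mulVf // scalar1 mulVf.
    by rewrite !chiD !chiN invfM mulrCA !mulrA.
  move/(chart_monomial _)=> []; first by rewrite invr_eq0.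
  by move=> _ /(_ F); rewrite inE eqxx; apply.
have le2 : 0 <= pairing (m + m2 - m1) F.
  have : line_div a [set F] (f * chi k m2).
    by apply/(h' _ nF); rewrite mulrAC divff // mul1r (line_div_principal hm2 e2).
  rewrite (line_div_principal hm1 e1) /principal_ideal ef -mulrA -mulrA -chiN -!chiD addrA.
  by case/(chart_monomial c0) => _ /(_ F); rewrite inE eqxx; apply.
move: le1 le2; rewrite !pairingD !pairingN e1 ?inE // e2 ?inE //; lia.
Qed.

Lemma line_div_is_bundle a : is_bundle M G (sheaf_of_line (@line_div k E a)).
Proof.
split=> [S nS|S S' nS' SS' v] /=.
  have [m hm e] := exists_line_equation a nS; rewrite (line_div_principal hm e).
  exact: (principal_locally_free (chart_subring k S) (chi_neq0 k m)).
have [m hm e] := exists_line_equation a nS'.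
have eS F : F \in S -> pairing m F = - a F by move=> FS; apply: e; apply: (subsetP SS').
have sub := principal_submod (chart_subring k S) (chi k m).
rewrite (line_div_principal hm eS) (line_div_principal hm e); split.
  move=> Rv; have -> : v = (v 0 0 / chi k m) *: (chi k m)%:M.
    by apply/rowP => j; rewrite !ord1 !mxE eqxx mulr1n divfK ?chi_neq0.
  apply: (submodZ (lspan_submod (chart_subring k S) _)) => //.
  apply: (lspan_gen (chart_subring k S)); rewrite mxE eqxx mulr1n /principal_ideal.
  rewrite divff ?chi_neq0 //; exact: (subring1 (chart_subring k _)).
apply: (lspan_min (chart_subring k S)
  (P := fun w : 'rV[L]_1 => principal_ideal (R S) (chi k m) (w 0 0))).
  by split=> [|c u w Rc hu hw]; rewrite !mxE; [case: sub | apply: sub.2].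
by move=> w; apply: chart_sub.
Qed.

Lemma pic_line_div a : pic (K_class M G (sheaf_of_line (@line_div k E a))) = Pic_pi (Lin a).
Proof.
rewrite (pic_class (line_div_is_bundle a)); congr Pic_pi; apply: invline_eq => t.
have [hsub _] := line_div_invertible a t.
exact: (det_ideal_line (chart_subring k (val t)) hsub).
Qed.

Lemma line1E : @line1 k E = line_div (0 : {ffun {set E} -> int}).
Proof.
apply/funext => S; apply/funext => v; apply/propext.
by split; apply: char_span_sub => m h F /h; rewrite ffunE oppr0.
Qed.

Lemma pic_line1 : pic (K_class M G (sheaf_of_line (@line1 k E))) = 0.
Proof. by rewrite line1E pic_line_div -[LHS]/(div_pic 0) raddf0. Qed.

Lemma line_of_divcl D a : D = divcl M G a ->
  exists2 b, D = divcl M G b & line_of D = line_div b :> line k E.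
Proof.
move=> e; exists (some_st (fun=> 0) (fun a => D = divcl M G a)) => //.
by apply: (@some_stP _ _ (fun a => D = divcl M G a)); exists a.
Qed.

(** The divisor chosen by [line_of] is only known up to linear equivalence, which the class in [Pic]
    does not see. *)
Lemma pic_O (a : {ffun {set E} -> int}) : pic (O_ k (div_chow a)) = div_pic a.
Proof.
have [b eb lb] := line_of_divcl (erefl (div_chow a)).
by rewrite /O_ lb pic_line_div; apply/eq_linear_equivalent.
Qed.

(** The divisor [a] witnesses that the choice in [c1] succeeds, so the default 0 is not taken;
    [eq_linear_equivalent] makes the chosen class unique. *)
Lemma c1_eq (xi : K0 k M G) (a : {ffun {set E} -> int}) :
  pic xi = div_pic a -> c1 xi = div_chow a.
Proof.
move=> e.
have isoP b : line_iso M G (line_div b) (K_det xi) <-> Pic_pi (Lin b) = pic xi.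
  by apply: line_isoP => // t; apply: K_det_il.
rewrite /c1; have [|b -> /isoP] := @some_stP _ 0 (fun D => exists2 a, D = divcl M G a &
    line_iso M G (line_div a) (K_det xi)).
  by exists (div_chow a), a => //; apply/isoP.
by rewrite e => /eq_linear_equivalent.
Qed.

Definition alpha_div (i : E) : {ffun {set E} -> int} := [ffun F : {set E} => (i \in F)%:Z].
Definition ray_div F : {ffun {set E} -> int} := [ffun H => (H == F)%:Z].
Definition theta_div i (F : {set E}) : {ffun {set E} -> int} :=
  alpha_div i - \sum_(H in G :\ setT | F \subset H) ray_div H.
(** The first Chern class of the tangent class, with the theta terms already cancelled. *)
Definition tangent_div i : {ffun {set E} -> int} := alpha_div i *+ M setT +
  \sum_(F in G :\ setT) (ray_div F - ray_div F *+ M F).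

Lemma div_chow_alpha i : div_chow (alpha_div i) = alpha M G i.
Proof. by rewrite alpha_divcl; apply: divcl_ext => F _; rewrite ffunE. Qed.

Lemma div_chow_ray F : F \in G :\ setT -> div_chow (ray_div F) = x_ M G F.
Proof. by move=> FG; rewrite x_divcl //; apply: divcl_ext => H _; rewrite ffunE. Qed.

Lemma div_chow_theta i F : div_chow (theta_div i F) = theta M G i F.
Proof.
rewrite /theta_div raddfB (raddf_sum div_chow) /=.
rewrite div_chow_alpha (eq_bigr (x_ M G)) // => H /andP[HG _].
exact: div_chow_ray.
Qed.

Lemma pic_tangent i : pic (tangent k M G i) = div_pic (tangent_div i).
Proof.
rewrite /tangent raddfD raddfB raddfMn (raddf_sum (@pic k E M G)) /= pic_line1 subr0.
rewrite -div_chow_alpha pic_O /tangent_div raddfD raddfMn (raddf_sum div_pic); congr (_ + _).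
apply: eq_bigr => F FG.
rewrite raddfD raddfB raddfMn raddfB /= pic_line1 subr0 -div_chow_theta -div_chow_ray //.
rewrite -(raddfD div_chow) !pic_O.
have -> : div_pic (theta_div i F + ray_div F) = div_pic (theta_div i F) + div_pic (ray_div F).
  exact: raddfD.
(* The theta terms cancel, leaving minus the ray of [F], taken rk(F) times. *)
rewrite opprD addrA subrr sub0r mulNrn.
by rewrite (raddfB div_pic) (raddfMn div_pic).
Qed.

Lemma canonical_class_div i : canonical_class k M G i = div_chow (- tangent_div i).
Proof. by rewrite /canonical_class (c1_eq (pic_tangent i)) raddfN. Qed.

Lemma canonical_classE i : canonical_class k M G i =
  - (alpha M G i *+ M setT) + \sum_(F in G :\ setT) x_ M G F *~ ((M F)%:Z - 1).
Proof.
rewrite canonical_class_div raddfN raddfD raddfMn (raddf_sum div_chow) /= div_chow_alpha opprD.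
congr (_ + _); rewrite -sumrN; apply: eq_bigr => F FG.
by rewrite raddfB raddfMn /= div_chow_ray // opprB mulrzBr mulr1z.
Qed.

Lemma canonical_line_iso i : line_iso M G (line_of (canonical_class k M G i))
  (K_det (K_dual (tangent k M G i))).
Proof.
have [b eb lb] := line_of_divcl (canonical_class_div i).
apply/(@line_isoP _ _ _ _ _ _ (Lin b) (Det (repr (K_dual (tangent k M G i))))).
- by move=> t; rewrite lb.
- by move=> t; apply: K_det_il.
rewrite -/(pic _) pic_dual pic_tangent -raddfN; apply/eq_linear_equivalent.
by rewrite -eb canonical_class_div.
Qed.

Definition canonical_div i : {set E} -> int :=
  fun F => - ((i \in F)%:Z *+ M setT) + ((M F)%:Z - 1).

Lemma canonical_class_divcl i : canonical_class k M G i = divcl M G (canonical_div i).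
Proof.
rewrite canonical_classE divclD divclN alpha_divcl /divcl -sumrMnl; congr (- _ + _).
by apply: eq_bigr => F _; rewrite -mulrz_nat -mulrzA mulr_natr.
Qed.

End Divisors.

(** * Pullback of divisors and the blow-up formula *)

Section Pullback.
Variables (k : fieldType) (E : finType) (M : matroid E) (B : {set {set E}}) (F : {set E}).
Hypotheses (hM : loopless M) (hB : building_set M B) (hB' : building_set M (F |: B)).
Hypotheses (topB : setT \in B) (FB : F \notin B).
Implicit Types (a b : {set E} -> int) (H : {set E}).

Let flF : flat M F. Proof. exact/(building_flat hB')/setU11. Qed.
Let F0 : F != set0. Proof. exact/(building_neq0 hB')/setU11. Qed.
Let FT : F != setT. Proof. by apply: contraNneq FB => ->. Qed.

(** Since v_F is the sum of the vectors of the factors, a local equation has along the new ray the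
    sum of its multiplicities along them. *)
Definition pullback_div a : {set E} -> int :=
  fun H => if H == F then \sum_(K in Fac B F) a K else a H.

Lemma mem_blowup H : H \in (F |: B) :\ setT -> H = F \/ H \in B /\ H != setT.
Proof. by rewrite !inE => /andP[HT /orP[/eqP->|HB]]; [left | right]. Qed.

Lemma pullback_divP a : div_pullback M B (F |: B) a (pullback_div a).
Proof.
move=> H HB' S nS cH m [hm em]; rewrite /pullback_div.
have [HF|HF] := eqVneq H F.
  rewrite HF in cH *; rewrite (pairing_Fac hM hB) //; apply: eq_bigr => K KF.
  rewrite em //; exact: (subsetP (in_cone_Fac hM hB topB flF F0 nS FT cH)).
case: (mem_blowup HB') => [/eqP|[HB HT]]; first by rewrite (negPf HF).
by rewrite em //; apply: (in_cone_mem hB topB nS HB HT cH).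
Qed.

Lemma exists_cone H : H \in (F |: B) :\ setT -> exists2 S, nested M B S & in_cone S H.
Proof.
case/mem_blowup=> [->|[HB HT]].
  by exists (Fac B F); [apply: nested_Fac | apply: (in_cone_FacF hM hB)].
exists [set H]; first by apply: nested_small; rewrite ?cards1 // sub1set !inE HT.
exists (fun=> 1), 0; split=> // i.
by rewrite big_set1 mul1r addr0.
Qed.

(** [pullback] may choose another representative [a'] of the class. It differs from [a] by a
    character [m0], and since every ray upstairs lies in some cone downstairs, the pullbacks differ
    by the same character. *)
Lemma pullback_divcl a :
  pullback (F |: B) (divcl M B a) = divcl M (F |: B) (pullback_div a).
Proof.
rewrite /pullback.
have [|a' [b [/divcl_eqP[m0 hm0 e0] -> hb]]] := @some_stP _ 0 (fun D' => exists a' b,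
    [/\ divcl M B a = divcl M B a', D' = divcl M (F |: B) b &
        div_pullback M B (F |: B) a' b]).
  exists (divcl M (F |: B) (pullback_div a)), a, (pullback_div a).
  by split=> //; apply: pullback_divP.
apply/divcl_eqP; exists (- m0); first exact: characterN.
move=> H HB'; have [S nS cH] := exists_cone HB'.
have [m [hm em]] := exists_local_equation hM hB topB a' nS.
(* Adding [m0] turns a local equation of the chosen divisor [a'] into one of [a]. *)
have eqm : local_equation a S (m + m0).
  split=> [|K KS]; first exact: characterD.
  have KB : K \in B :\ setT by case/andP: nS => /subsetP SB _; apply: SB.
  by rewrite pairingD (em K KS) -(e0 K KB) addrC subrK.
rewrite (hb H HB' S nS cH m) // (pullback_divP HB' nS cH eqm) pairingD pairingN.
by rewrite opprD addrA subrr sub0r.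
Qed.

(** Membership of [i] and the rank are additive over the factors; the constant -1 occurs once for
    [F] but once per factor in the sum. *)
Lemma canonical_div_blowup i :
  canonical_div M i F = \sum_(K in Fac B F) canonical_div M i K + (#|Fac B F|%:Z - 1).
Proof.
rewrite /canonical_div big_split /= sumrN sumrB sumr_const natz sumrMnl.
have -> : \sum_(K in Fac B F) (i \in K)%:Z = (i \in F)%:Z.
  rewrite -natz -pairing_unit (pairing_Fac hM hB) //.
  by apply: eq_bigr => K _; rewrite pairing_unit natz.
rewrite (rk_Fac hM hB flF F0) (big_morph Posz PoszD (erefl : Posz 0 = 0)).
by rewrite -[RHS]addrA; congr (_ + _); rewrite addrA subrK.
Qed.

Lemma canonical_class_blowup i : canonical_class k M (F |: B) i =
  pullback (F |: B) (canonical_class k M B i) + x_ M (F |: B) F *~ (#|Fac B F|%:Z - 1).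
Proof.
have topB' : setT \in F |: B by rewrite inE topB orbT.
rewrite !canonical_class_divcl // pullback_divcl.
have FB' : F \in (F |: B) :\ setT by rewrite !inE FT eqxx.
have -> : x_ M (F |: B) F *~ (#|Fac B F|%:Z - 1) =
    divcl M (F |: B) (fun H => (H == F)%:Z * (#|Fac B F|%:Z - 1)).
  rewrite x_divcl // /divcl mulrz_suml; apply: eq_bigr => H _.
  by rewrite mulrzA.
rewrite -divclD; apply: divcl_ext => H _; rewrite /pullback_div.
case: eqP => [->|_]; last by rewrite mul0r addr0.
by rewrite mul1r canonical_div_blowup.
Qed.

End Pullback.

Theorem corollary4p13 (k : fieldType) (E : finType) (M : matroid E) (i : E)
    (hM : loopless M) :
  (forall G : {set {set E}}, building_set M G -> setT \in G ->
     canonical_class k M G i =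
       - (alpha M G i *+ M setT)
       + \sum_(F in G :\ setT) x_ M G F *~ ((M F)%:Z - 1)
     /\ line_iso M G (line_of (canonical_class k M G i))
                     (K_det (K_dual (tangent k M G i))))
  /\
  (forall (B : {set {set E}}) (F : {set E}),
     building_set M B -> building_set M (F |: B) -> setT \in B -> F \notin B ->
     canonical_class k M (F |: B) i =
       pullback (F |: B) (canonical_class k M B i)
       + x_ M (F |: B) F *~ (#|Fac B F|%:Z - 1)).
Proof.
split=> [G hG topG|B F hB hB' topB FB]; last exact: canonical_class_blowup.
by split; [apply: canonical_classE | apply: canonical_line_iso].
Qed.
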